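(* Let $H$ be a $3$-uniform hypergraph with $|V(H)|=n$ that has an exact fractional edge cover. Then $\rho(H)\le \frac{n}{2}$.
   Context: A hypergraph $H=(V,E)$ consists of a non-empty finite set $V=V(H)$ of vertices and a family $E=E(H)$ of subsets of $V$ called edges; all edges are non-empty and every vertex belongs to at least one edge. $H$ is $3$-uniform if $|e|=3$ for every $e\in E$. An edge cover in $H$ is a subfamily $E'\subseteq E$ with $\bigcup E'=V$, and $\rho(H)$ is the minimum of $|E'|$ over all edge covers $E'$. An exact fractional edge cover in $H$ is a function $f:E\to\mathbb{R}_+$ (non-negative reals) with $\sum_{e\ni v}f(e)=1$ for every $v\in V$. *)

(* Defs.v *)
From mathcomp Require Import all_boot all_order all_algebra.
From mathcomp Require Import reals.

Set Implicit Arguments.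
Unset Strict Implicit.
Unset Printing Implicit Defensive.

Import Order.TTheory GRing.Theory Num.Theory.

Record hypergraph := Hypergraph {
  vertex : finType;
  edges : {set {set vertex}};
  vertex_nonempty : (0 < #|vertex|)%N;
  edge_nonempty : forall e, e \in edges -> e != set0;
  vertex_covered : forall v : vertex, exists2 e, e \in edges & v \in e
}.

Definition uniform (k : nat) (H : hypergraph) : Prop :=
  forall e, e \in edges H -> #|e| = k.

Definition edge_cover (H : hypergraph) (F : {set {set vertex H}}) : bool :=
  (F \subset edges H) && (cover F == [set: vertex H]).

(* [edges H] serves only as the starting point of the minimization: it is an
   edge cover by [edge_cover_edges], so the minimum is attained. *)
Definition rho (H : hypergraph) : nat :=
  #|[arg min_(F < edges H | edge_cover F) #|F|]|.

(* Only the values of [f] on [edges H] matter. *)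
Definition exact_fractional_edge_cover (R : realType) (H : hypergraph)
    (f : {set vertex H} -> R) : Prop :=
  (forall e, e \in edges H -> (0 <= f e)%R) /\
  (forall v : vertex H, (\sum_(e in edges H | v \in e) f e = 1)%R).

Lemma edge_cover_edges (H : hypergraph) : edge_cover (edges H).
Proof.
rewrite /edge_cover subxx /=; apply/eqP/setP=> v; rewrite inE.
by have [e eE ve] := vertex_covered v; apply/bigcupP; exists e.
Qed.

Lemma rho_attained (H : hypergraph) :
  exists2 F : {set {set vertex H}}, edge_cover F & #|F| = rho H.
Proof.
rewrite /rho; case: arg_minnP => [|F covF _]; first exact: edge_cover_edges.
by exists F.
Qed.

Lemma rho_le (H : hypergraph) (F : {set {set vertex H}}) :
  edge_cover F -> (rho H <= #|F|)%N.
Proof.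
rewrite /rho; case: arg_minnP => [|G _ minG]; first exact: edge_cover_edges.
exact: minG.
Qed.

(* Main.v *)
(** Let [g] be the graph of pairs contained in faces of positive weight. Call a
    vertex set critical if it is factor-critical in [g] and removing a face of
    size three never leaves a perfect matching. A Gallai-Edmonds argument yields
    either a cover by at most n/2 edges, or a set [A] whose removal leaves more
    than |A| critical components. The weight available at [A] rules out the
    latter once every critical set [U] with |U| > 1 is known to be crossed by
    faces of total weight at least 3/2 (theorem [star]).

    For [star], take a counterexample with |U| and then the support minimal; the
    faces become linearly independent. An edge of [g] lying in a triangle whose
    complement in [U] has no perfect matching can be deleted without destroying
    factor-criticality. Hence the faces traced on [U], as functionals on vertex
    vectors, have no common kernel, so there are exactly |U| of them, none is a
    singleton, and deleting any one of them destroys factor-criticality. The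
    components produced by such a deletion are smaller critical sets, and
    induction bounds the weight of the deleted face; this leaves at most two
    faces of size two and a few explicit cases. *)

Require Import Defs.
From mathcomp Require Import all_boot all_order all_algebra.
From mathcomp Require Import reals.
From mathcomp Require Import zify ring lra.

Set Implicit Arguments.
Unset Strict Implicit.
Unset Printing Implicit Defensive.
Import Order.TTheory GRing.Theory Num.Theory.

(** * Matchings and factor-critical sets *)

Section Matched.
Variable V : finType.
Implicit Types (g : rel V) (U W A B K : {set V}) (D : {set {set V}}).

Definition pairing g W (f : V -> V) :=
  forall x, x \in W -> [/\ f x \in W, f x != x, f (f x) = x & g x (f x)].

Definition matched g W : bool :=
  [exists f : {ffun V -> V},
    [forall x in W, [&& f x \in W, f x != x, f (f x) == x & g x (f x)]]].

Lemma matchedP g W : reflect (exists f, pairing g W f) (matched g W).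
Proof.
apply: (iffP existsP) => [[f /forall_inP fP]|[f fP]].
  by exists f => x /fP /and4P[? ? /eqP ? ?].
exists (finfun f); apply/forall_inP => x /fP [? ? fxK ?].
by rewrite !ffunE fxK; apply/and4P.
Qed.

Lemma matched0 g : matched g set0.
Proof. by apply/matchedP; exists id => x; rewrite inE. Qed.

Lemma matchedU g W1 W2 : [disjoint W1 & W2] ->
  matched g W1 -> matched g W2 -> matched g (W1 :|: W2).
Proof.
move=> dis /matchedP[f1 f1P] /matchedP[f2 f2P]; apply/matchedP.
exists (fun x => if x \in W1 then f1 x else f2 x) => x.
rewrite !inE; case: ifPn => [x1 _|xN1 /= x2].
  by have [f1x ? ? ?] := f1P x x1; rewrite f1x.
have [f2x ? ? ?] := f2P x x2; rewrite f2x orbT.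
by have /negPf -> : f2 x \notin W1 by rewrite (disjointFl dis).
Qed.

Lemma matched_pair g x y : x != y -> g x y -> g y x -> matched g [set x; y].
Proof.
move=> xy gxy gyx; apply/matchedP.
exists (fun z => if z == x then y else x) => z; rewrite !inE.
case/orP => /eqP ->; last by rewrite [y == x]eq_sym (negPf xy) !eqxx.
by rewrite !eqxx orbT [y == x]eq_sym (negPf xy).
Qed.

Lemma sub_matched g g' W : {in W &, forall x y, g x y -> g' x y} ->
  matched g W -> matched g' W.
Proof.
move=> gg' /matchedP[f fP]; apply/matchedP; exists f => x xW.
by have [fxW ? ? gx] := fP x xW; split=> //; apply: gg'.
Qed.

Lemma pairing_sub g W W' f : pairing g W f -> W' \subset W ->
  {in W', forall x, f x \in W'} -> matched g W'.
Proof.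
move=> fP sW fW; apply/matchedP; exists f => x xW'.
by have [_ ? ? ?] := fP x (subsetP sW x xW'); split=> //; apply: fW.
Qed.

Lemma pairingD g W f x : pairing g W f -> x \in W ->
  matched g (W :\: [set x; f x]).
Proof.
move=> fP xW; apply: (pairing_sub fP); first exact: subsetDl.
move=> z; rewrite !inE negb_or => /andP[/andP[zx zfx] zW].
have [fzW _ fzK _] := fP z zW; rewrite fzW andbT negb_or.
apply/andP; split; apply/eqP => e; first by rewrite -fzK e eqxx in zfx.
by have [_ _ fxK _] := fP x xW; rewrite -fzK e fxK eqxx in zx.
Qed.

Lemma matched_ind g (P : {set V} -> Prop) :
  P set0 ->
  (forall x y W, x != y -> x \notin W -> y \notin W -> g x y -> matched g W ->
     P W -> P (x |: (y |: W))) ->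
  forall W, matched g W -> P W.
Proof.
move=> P0 PS W; have [n] := ubnP #|W|; elim: n W => // n IH W ltW mW.
have [->//|[x xW]] := set_0Vmem W.
have /matchedP[f fP] := mW; have [fxW fxx fxK gx] := fP x xW.
have -> : W = x |: (f x |: W :\: [set x; f x]).
  apply/setP => z; rewrite !inE negb_or.
  by case: eqP => [->//|_]; case: eqP => [->//|_].
have mD := pairingD fP xW.
apply: PS => //; rewrite ?inE ?eqxx ?orbT // 1?eq_sym //.
apply: IH => //; rewrite -ltnS; apply: leq_trans ltW.
rewrite ltnS; apply: proper_card; apply/properP; split; first exact: subsetDl.
by exists x; rewrite // !inE eqxx.
Qed.

Lemma matched_even g W : matched g W -> ~~ odd #|W|.
Proof.
move: W; apply: matched_ind => [|x y W xy xW yW _ _ ev]; first by rewrite cards0.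
by rewrite !cardsU1 !inE negb_or xy xW yW /= negbK.
Qed.

Definition fcrit g W :=
  (W != set0) && [forall x in W, matched g (W :\ x)].

Lemma fcrit_matched g W x : fcrit g W -> x \in W -> matched g (W :\ x).
Proof. by case/andP => _ /forall_inP; apply. Qed.

Lemma fcrit_odd g W : fcrit g W -> odd #|W|.
Proof.
move=> fW; have /andP[/set0Pn[x xW] _] := fW.
by have := matched_even (fcrit_matched fW xW); rewrite (cardsD1 x W) xW /= => ->.
Qed.

Lemma sub_fcrit g g' W : {in W &, forall x y, g x y -> g' x y} ->
  fcrit g W -> fcrit g' W.
Proof.
move=> gg' fW; have /andP[W0 _] := fW; rewrite /fcrit W0.
apply/forall_inP => x xW; apply: sub_matched (fcrit_matched fW xW) => y z.
by rewrite !inE => /andP[_ ?] /andP[_ ?]; apply: gg'.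
Qed.

Lemma fcrit_nbr g W x z : fcrit g W -> x \in W -> z \in W -> z != x ->
  exists y, [/\ y \in W, y != x, y != z & g x y].
Proof.
move=> fW xW zW zx; have /matchedP[f fP] := fcrit_matched fW zW.
have [|fxW ? _ ?] := fP x; first by rewrite !inE eq_sym zx.
by move: fxW; rewrite !inE => /andP[? ?]; exists (f x).
Qed.

(** The path through [z1] and [z2] is an odd ear whose two ends on [W] may coincide. When one new
    point is deleted, the other is paired with a neighbour in [W]; when a point of [W] is deleted,
    the two new points are paired with each other. *)
Lemma fcrit_ear g W z1 z2 : symmetric g -> fcrit g W ->
  z1 \notin W -> z2 \notin W -> z1 != z2 -> g z1 z2 ->
  (exists2 x, x \in W & g x z1) -> (exists2 x, x \in W & g x z2) ->
  fcrit g (z1 |: (z2 |: W)).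
Proof.
move=> gs fW z1W z2W z12 g12 a1 a2.
have aux z z' : z != z' -> z \notin W -> z' \notin W ->
    (exists2 x, x \in W & g x z') -> matched g ((z |: (z' |: W)) :\ z).
  move=> zz' zW z'W [x xW gxz].
  have -> : (z |: (z' |: W)) :\ z = [set x; z'] :|: (W :\ x).
    apply/setP => t; rewrite !inE.
    have [->|_] := eqVneq t z; last by case: (eqVneq t x) => [->|_]; rewrite ?xW ?orbT.
    by rewrite (negPf zW) (negPf zz') andbF !orbF; apply/esym/negbTE; apply: contra zW => /eqP ->.
  apply: matchedU; last exact: fcrit_matched.
    rewrite -setI_eq0; apply/eqP/setP => t; rewrite !inE.
    by case: eqP => //= _; case: eqP => //= ->; rewrite (negPf z'W).
  by apply: matched_pair; rewrite // 1?gs //; apply: contraNneq z'W => <-.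
apply/andP; split; first by apply/set0Pn; exists z1; rewrite !inE eqxx.
apply/forall_inP => x; rewrite !inE => /or3P[/eqP->|/eqP->|xW].
- exact: aux.
- by rewrite setUCA; apply: aux; rewrite // eq_sym.
have xz1 : x != z1 by apply: contraNneq z1W => <-.
have xz2 : x != z2 by apply: contraNneq z2W => <-.
have -> : (z1 |: (z2 |: W)) :\ x = [set z1; z2] :|: (W :\ x).
  apply/setP => t; rewrite !inE; case: (eqVneq t x) => [->|_] /=.
    by rewrite (negPf xz1) (negPf xz2).
  by rewrite orbA.
apply: matchedU; last exact: fcrit_matched.
  rewrite -setI_eq0; apply/eqP/setP => t; rewrite !inE.
  by case: eqP => [->|_]; [rewrite (negPf z1W) andbF|case: eqP => //= ->; rewrite (negPf z2W) andbF].
by apply: matched_pair; rewrite // gs.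
Qed.

End Matched.

(** * Hall's marriage theorem *)

Section Hall.
Variables S T : finType.
Implicit Types (X : {set S}) (r : S -> T -> bool).

Definition nbrs r X : {set T} := [set y | [exists x in X, r x y]].

Lemma nbrsP r X y : reflect (exists2 x, x \in X & r x y) (y \in nbrs r X).
Proof. by rewrite inE; apply: exists_inP. Qed.

(* Either some nonempty proper subset is tight, and one matches it first and
   then its complement, or one vertex can be matched arbitrarily. *)
Lemma hall (t0 : T) r X : (forall X', X' \subset X -> #|X'| <= #|nbrs r X'|) ->
  exists f : S -> T, {in X, forall x, r x (f x)} /\ {in X &, injective f}.
Proof.
have [n] := ubnP #|X|; elim: n r X => // n IH r X ltX hX.
have [->|[x0 x0X]] := set_0Vmem X.
  by exists (fun=> t0); split => x; rewrite inE.
have [/existsP[X1 /and4P[sX1 ne1 nX1 /eqP tight]]|/existsPn noX1] :=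
  boolP [exists X1 : {set S}, [&& X1 \subset X, X1 != set0, X1 != X
    & #|nbrs r X1| == #|X1|]].
- have lt1 : #|X1| < #|X| by apply: proper_card; rewrite properEneq nX1.
  have pos1 : 0 < #|X1| by rewrite card_gt0.
  have cD : #|X :\: X1| = #|X| - #|X1| by rewrite cardsD (setIidPr sX1).
  have [||f1 [f1r f1i]] := IH r X1; first by lia.
    by move=> X' sX'; apply: hX; apply: subset_trans sX1.
  have [||f2 [f2r f2i]] := IH (fun x y => r x y && (y \notin nbrs r X1)) (X :\: X1).
  + by rewrite cD; lia.
  + move=> X' sX'.
    have : #|X' :|: X1| <= #|nbrs r (X' :|: X1)|.
      by apply: hX; rewrite subUset sX1 andbT (subset_trans sX') // subsetDl.
    have -> : #|X' :|: X1| = #|X'| + #|X1|.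
      rewrite cardsU; have -> : X' :&: X1 = set0; last by rewrite cards0 subn0.
      apply/setP => x; rewrite !inE; apply/negbTE/negP => /andP[/(subsetP sX')].
      by rewrite inE => /andP[/negP].
    move=> le1; rewrite -(leq_add2r #|X1|); apply: leq_trans le1 _; rewrite -tight.
    apply: leq_trans (leq_card_setU _ _).1; apply: subset_leq_card.
    apply/subsetP => y /nbrsP[x xU rxy]; rewrite in_setU.
    have [_|yN] := boolP (y \in nbrs r X1); first by rewrite orbT.
    rewrite orbF; apply/nbrsP; exists x; last by rewrite rxy.
    by case/setUP: xU => // x1; case/nbrsP: yN; exists x.
  exists (fun x => if x \in X1 then f1 x else f2 x); split=> [x xX|x y xX yX].
    case: ifPn => xX1; first exact: f1r.
    by have /andP[] : r x (f2 x) && (f2 x \notin nbrs r X1) by apply: f2r; rewrite inE xX1.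
  have f1N z : z \in X1 -> f1 z \in nbrs r X1.
    by move=> z1; apply/nbrsP; exists z => //; apply: f1r.
  have f2N z : z \in X -> z \notin X1 -> f2 z \notin nbrs r X1.
    move=> zX z1; have /andP[] // : r z (f2 z) && (f2 z \notin nbrs r X1).
    by apply: f2r; rewrite inE z1.
  case: ifPn => x1; case: ifPn => y1 e.
  + exact: f1i.
  + by have := f2N y yX y1; rewrite -e f1N.
  + by have := f2N x xX x1; rewrite e f1N.
  + by apply: f2i; rewrite ?inE ?x1 ?y1.
have [y0 rxy0] : exists y0, r x0 y0.
  have : 0 < #|nbrs r [set x0]|.
    by apply: leq_trans (hX [set x0] _); rewrite ?cards1 ?sub1set.
  by case/card_gt0P => y0 /nbrsP[_ /set1P-> ?]; exists y0.
have [||f [fr fi]] := IH (fun x y => r x y && (y != y0)) (X :\ x0).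
- by move: ltX; rewrite (cardsD1 x0 X) x0X; lia.
- move=> X' sX'; have [->|X'0] := eqVneq X' set0; first by rewrite cards0.
  have sX : X' \subset X by rewrite (subset_trans sX') // subD1set.
  have nX : X' != X.
    by apply: contraTneq sX' => ->; apply/subsetPn; exists x0; rewrite // !inE eqxx.
  have ltN : #|X'| < #|nbrs r X'|.
    by have := noX1 X'; rewrite sX X'0 nX /= ltn_neqAle eq_sym hX // => ->.
  have -> : nbrs (fun x y => r x y && (y != y0)) X' = nbrs r X' :\ y0.
    apply/setP => y; rewrite in_setD1; apply/nbrsP/andP.
      by case=> x xX' /andP[rxy yy0]; split=> //; apply/nbrsP; exists x.
    by case=> yy0 /nbrsP[x xX' rxy]; exists x => //; rewrite rxy.
  by move: ltN; rewrite (cardsD1 y0 (nbrs r X')); case: (y0 \in _) => /=; lia.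
exists (fun x => if x == x0 then y0 else f x).
have frx x : x \in X -> x != x0 -> r x (f x) && (f x != y0).
  by move=> xX xx0; apply: fr; rewrite !inE xx0.
split=> [x xX|x y xX yX]; first by case: eqP => [->//|/eqP/(frx x xX)/andP[]].
case: eqP => [->|/eqP xx0]; case: eqP => [->|/eqP yx0] // e.
- by have /andP[_] := frx y yX yx0; rewrite e eqxx.
- by have /andP[_] := frx x xX xx0; rewrite -e eqxx.
- by apply: fi; rewrite // !inE ?xx0 ?yx0.
Qed.

End Hall.

(** * Barriers with factor-critical components *)

Section Config.
Variable V : finType.
Implicit Types (g : rel V) (U W A B K : {set V}) (D X : {set {set V}}).

(** A barrier as in Tutte's theorem: for symmetric [g], factor-critical sets are connected, so the
    members of [D] are components of [g] on [U :\: A]. Other components may be left out of [D],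
    which allows passing to subfamilies. *)
Definition config g U A D :=
  [&& A \subset U, trivIset D,
      [forall K in D, fcrit g K && (K \subset U :\: A)]
    & [forall K in D, forall x in K, forall y in U, g x y ==> (y \in K :|: A)]].

Lemma configP g U A D :
  reflect [/\ A \subset U, trivIset D, {in D, forall K, fcrit g K},
              {in D, forall K, K \subset U :\: A}
            & forall K x y, K \in D -> x \in K -> y \in U -> g x y -> y \in K :|: A]
          (config g U A D).
Proof.
apply: (iffP and4P) => [[AU tD /forall_inP KD /forall_inP cD]|[AU tD fD sD cD]].
  split=> // [K /KD/andP[]//|K /KD/andP[]//|K x y /cD/forall_inP cK /cK].
  by move/forall_inP => cx /cx/implyP.
split=> //; first by apply/forall_inP => K KD; rewrite fD ?sD.
apply/forall_inP => K KD; apply/forall_inP => x xK; apply/forall_inP => y yU.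
by apply/implyP; apply: cD.
Qed.

Lemma config_unique g U A D K K' x : config g U A D ->
  K \in D -> K' \in D -> x \in K -> x \in K' -> K = K'.
Proof.
case/configP => _ /trivIsetP tD _ _ _ KD K'D xK xK'; apply/eqP/negPn/negP => ne.
by have := tD K K' KD K'D ne; rewrite -setI_eq0 => /eqP/setP/(_ x); rewrite !inE xK xK'.
Qed.

Lemma config_coverP g U A D : config g U A D -> cover D \subset U :\: A.
Proof. by case/configP => _ _ _ sD _; apply/bigcupsP. Qed.

Lemma config_card g U A D : config g U A D -> odd #|cover D| = odd #|D|.
Proof.
case/configP => _ /eqP <- fD _ _; rewrite -[#|D|]sum1_card.
by elim/big_rec2: _ => // K m n KD e; rewrite !oddD e (fcrit_odd (fD K KD)).
Qed.

Definition adj g A K a := (a \in A) && [exists x in K, g x a].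

Lemma config_nbrs g U A D X : config g U A D -> X \subset D ->
  config g U (nbrs (adj g A) X) X.
Proof.
case/configP => AU tD fD sD cD /subsetP sX.
have sN : nbrs (adj g A) X \subset A.
  by apply/subsetP => a /nbrsP[K _ /andP[]].
apply/configP; split.
- exact: subset_trans sN AU.
- by apply: trivIsetS tD; apply/subsetP.
- by move=> K /sX/fD.
- by move=> K /sX/sD sK; apply: subset_trans sK _; apply: setDS.
- move=> K x y KX xK yU gxy; have := cD K x y (sX K KX) xK yU gxy.
  rewrite !in_setU => /orP[->//|yA]; apply/orP; right; apply/nbrsP; exists K => //.
  by rewrite /adj yA; apply/exists_inP; exists x.
Qed.

(** The leftover has no edge to a member of [D], so a barrier found there can be added, and the
    excesses |D| - |A| add up. *)
Lemma config_cat g U A D A' D' : symmetric g -> config g U A D ->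
  config g (U :\: A :\: cover D) A' D' ->
  config g U (A :|: A') (D :|: D') /\
  #|A :|: A'| = #|A| + #|A'| /\ #|D :|: D'| = #|D| + #|D'|.
Proof.
move=> gs cf cf'; have /configP[AU tD fD sD cD] := cf.
have /configP[A'U tD' fD' sD' cD'] := cf'.
have inR x : x \in U :\: A :\: cover D -> [/\ x \notin cover D, x \notin A & x \in U].
  by rewrite !in_setD => /and3P[].
have R' K x : K \in D' -> x \in K -> x \in (U :\: A :\: cover D) :\: A'.
  by move=> KD' xK; apply: subsetP (sD' K KD') x xK.
have dDD' K K' x : K \in D -> K' \in D' -> x \in K -> x \in K' -> False.
  move=> KD KD' xK /(R' _ _ KD'); rewrite in_setD => /andP[_ /inR[/negP[]]].
  by apply/bigcupP; exists K.
split; last split.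
- apply/configP; split.
  + rewrite subUset AU; apply/subsetP => x /(subsetP A'U)/inR[] //.
  + apply/trivIsetP => K K'; rewrite !in_setU => /orP[KD|KD] /orP[KD'|KD'] ne.
    * by move/trivIsetP: tD; apply.
    * by rewrite -setI_eq0; apply/eqP/setP => x; rewrite !inE; apply/negP => /andP[? ?];
        apply: (dDD' K K' x).
    * by rewrite -setI_eq0; apply/eqP/setP => x; rewrite !inE; apply/negP => /andP[? ?];
        apply: (dDD' K' K x).
    * by move/trivIsetP: tD'; apply.
  + by move=> K /setUP[/fD|/fD'].
  + move=> K /setUP[KD|KD]; apply/subsetP => x xK.
      have := subsetP (sD K KD) x xK; rewrite !inE negb_or => /andP[-> ->].
      rewrite !andbT /=; apply/negP => /(subsetP A'U)/inR[/negP[]].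
      by apply/bigcupP; exists K.
    by have := R' K x KD xK; rewrite in_setD => /andP[xA' /inR[_ xA xU]];
      rewrite !inE negb_or xA xA' xU.
  + move=> K x y /setUP[KD|KD] xK yU gxy.
      by have := cD K x y KD xK yU gxy; rewrite !in_setU => /orP[->|->]; rewrite ?orbT.
    have [yA|yA] := boolP (y \in A); first by rewrite !in_setU yA orbT.
    have [/bigcupP[K0 K0D yK0]|yc] := boolP (y \in cover D).
      have := R' K x KD xK; rewrite in_setD => /andP[_ /inR[/negP xc xA xU]].
      have := cD K0 y x K0D yK0 xU; rewrite gs gxy in_setU (negPf xA) orbF => /(_ isT) xK0.
      by case: xc; apply/bigcupP; exists K0.
    have := cD' K x y KD xK; rewrite !in_setD yc yA yU gxy !in_setU => /(_ isT isT).
    by case/orP => ->; rewrite ?orbT.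
- rewrite cardsU; have -> : A :&: A' = set0; last by rewrite cards0 subn0.
  apply/setP => x; rewrite !inE; apply/negP => /andP[xA /(subsetP A'U)/inR[_]].
  by rewrite xA.
- rewrite cardsU; have -> : D :&: D' = set0; last by rewrite cards0 subn0.
  apply/setP => K; rewrite !inE; apply/negP => /andP[KD KD'].
  have /andP[/set0Pn[x xK] _] := fD K KD; exact: (dDD' K K x).
Qed.

Lemma matched_add g K v x : symmetric g -> fcrit g K -> v \notin K -> x \in K ->
  g x v -> matched g (v |: K).
Proof.
move=> gs fK vK xK gxv.
have -> : v |: K = [set x; v] :|: (K :\ x).
  by apply/setP => t; rewrite !inE; case: (eqVneq t x) => [->|]; rewrite ?xK ?orbT.
apply: matchedU; last exact: fcrit_matched.
  rewrite -setI_eq0; apply/eqP/setP => t; rewrite !inE.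
  by case: eqP => //= _; case: eqP => //= ->; rewrite (negPf vK).
by apply: matched_pair; rewrite // 1?gs //; apply: contraNneq vK => <-.
Qed.

Lemma cover_setD1 D K : K \in D -> cover D = K :|: cover (D :\ K).
Proof. by move=> KD; rewrite /cover (big_setD1 K KD). Qed.

Lemma matched_glue g D (f : {set V} -> V) : symmetric g -> trivIset D ->
  {in D, forall K, fcrit g K} -> {in D &, injective f} ->
  {in D, forall K, f K \notin cover D} ->
  {in D, forall K, exists2 x, x \in K & g x (f K)} ->
  matched g (f @: D :|: cover D).
Proof.
move=> gs; have [n] := ubnP #|D|; elim: n D => // n IH D ltD tD fD fi fN fg.
have [->|[K KD]] := set_0Vmem D; first by rewrite imset0 /cover big_set0 setU0 matched0.
have sD : D :\ K \subset D by apply: subD1set.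
have ssD K' : K' \in D :\ K -> K' \in D by move/(subsetP sD).
have mR : matched g (f @: (D :\ K) :|: cover (D :\ K)).
  apply: IH.
  - by move: ltD; rewrite (cardsD1 K D) KD.
  - exact: trivIsetS tD.
  - by move=> K' /ssD/fD.
  - by move=> K1 K2 /ssD ? /ssD ?; apply: fi.
  - move=> K' /ssD K'D; apply: contra (fN K' K'D) => /bigcupP[K2 /ssD ? ?].
    by apply/bigcupP; exists K2.
  - by move=> K' /ssD/fg.
have mK : matched g (f K |: K).
  have [x xK gx] := fg K KD; apply: matched_add xK gx => //; first exact: fD.
  by apply: contra (fN K KD) => ?; apply/bigcupP; exists K.
have -> : f @: D :|: cover D = (f K |: K) :|: (f @: (D :\ K) :|: cover (D :\ K)).
  rewrite (cover_setD1 KD) -{1}(setD1K KD) imsetU1; apply/setP => t; rewrite !in_setU.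
  by rewrite -!orbA; do !bool_congr.
apply: matchedU => //; rewrite -setI_eq0; apply/eqP/setP => t; rewrite [RHS]inE.
apply/negP; rewrite in_setI => /andP[/setU1P[->|tK] /setUP[]].
- case/imsetP => K'; rewrite !inE => /andP[ne K'D] e.
  by have := fi _ _ KD K'D e => eK; rewrite eK eqxx in ne.
- move=> /bigcupP[K' /ssD K'D fK']; case/negP: (fN K KD); apply/bigcupP; exists K' => //.
- case/imsetP => K' /ssD K'D e; case/negP: (fN K' K'D); rewrite -e.
  by apply/bigcupP; exists K.
- case/bigcupP => K'; rewrite !inE => /andP[ne K'D] tK'.
  have := tD => /trivIsetP/(_ K' K K'D KD ne).
  by rewrite -setI_eq0 => /eqP/setP/(_ t); rewrite !inE tK tK'.
Qed.

Definition min_config g U A D := config g U A D /\ #|A| < #|D| /\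
  forall A' D', config g U A' D' -> #|A'| < #|D'| -> #|D| <= #|D'|.

Lemma min_configP g U A D : config g U A D -> #|A| < #|D| ->
  exists A' D', min_config g U A' D'.
Proof.
move=> cf lt.
pose P (p : {set V} * {set {set V}}) := config g U p.1 p.2 && (#|p.1| < #|p.2|).
have P0 : P (A, D) by rewrite /P /= cf lt.
case: (arg_minnP (fun p : {set V} * {set {set V}} => #|p.2|) P0) => -[A' D'] /andP[/= cf' lt'] mn.
exists A', D'; split=> //; split=> // A2 D2 cf2 lt2.
by apply: (mn (A2, D2)); rewrite /P /= cf2 lt2.
Qed.

(** With a larger excess, a member of [D] could be dropped without losing [#|A| < #|D|]. *)
Lemma min_config_card g U A D : min_config g U A D -> #|D| = #|A|.+1.
Proof.
case=> cf [lt mn]; apply/eqP; rewrite eqn_leq lt andbT leqNgt; apply/negP => gt.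
have /card_gt0P[K KD] : 0 < #|D| by lia.
have cD : #|D| = #|D :\ K|.+1 by rewrite (cardsD1 K D) KD.
have cf' := config_nbrs cf (subD1set D K).
have sN : #|nbrs (adj g A) (D :\ K)| <= #|A|.
  by apply: subset_leq_card; apply/subsetP => a /nbrsP[? _ /andP[]].
by have := mn _ _ cf'; lia.
Qed.

(** A violation of Hall's condition would be a smaller family that still exceeds its neighbours. So
    the members other than [K] are matched onto [A], and factor-criticality completes the matching
    inside each of them. *)
Lemma min_config_matched g U A D K : symmetric g -> min_config g U A D -> K \in D ->
  matched g (A :|: cover (D :\ K)).
Proof.
move=> gs mc KD; have cD := min_config_card mc; have [cf [lt mn]] := mc.
have /configP[AU tD fD sD clD] := cf.
have /andP[/set0Pn[x0 _] _] := fD K KD.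
have cDK : #|D :\ K| = #|A| by have := cardsD1 K D; rewrite KD cD /= add1n => -[].
have [X sX|f [fr fi]] := @hall _ _ x0 (adj g A) (D :\ K).
  rewrite leqNgt; apply/negP => ltX.
  have XD : X \subset D by rewrite (subset_trans sX) // subD1set.
  have leX := subset_leq_card sX; rewrite cDK in leX.
  by have := leq_trans (mn _ _ (config_nbrs cf XD) ltX) leX; rewrite cD ltnn.
have fA : f @: (D :\ K) = A.
  apply/eqP; rewrite eqEcard card_in_imset // cDK leqnn andbT.
  by apply/subsetP => _ /imsetP[K' K'D ->]; have /andP[] := fr K' K'D.
rewrite -{1}fA; apply: matched_glue => //.
- by apply: trivIsetS tD; apply: subD1set.
- by move=> K' /setD1P[_ /fD].
- move=> K' K'D; have /andP[fKA _] := fr K' K'D.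
  apply/bigcupP => -[K2 /setD1P[_ K2D] /(subsetP (sD K2 K2D))].
  by rewrite inE fKA.
- by move=> K' K'D; have /andP[_ /exists_inP[x ? ?]] := fr K' K'D; exists x.
Qed.

End Config.

(** * The alternative between a perfect matching and a barrier *)

Section GallaiTutte.
Variable V : finType.
Implicit Types (g : rel V) (U W A B K : {set V}) (D X : {set {set V}}).

Lemma config_split g U A D : config g U A D ->
  [disjoint A & cover D] /\ [disjoint A :|: cover D & U :\: A :\: cover D] /\
  U = (A :|: cover D) :|: (U :\: A :\: cover D).
Proof.
move=> cf; have /subsetP sC := config_coverP cf; have /configP[/subsetP AU _ _ _ _] := cf.
have dAC x : x \in A -> x \in cover D -> False.
  by move=> xA /sC; rewrite inE xA.
do !split.
- by rewrite -setI_eq0; apply/eqP/setP => x; rewrite !inE; apply/negP => /andP[]; apply: dAC.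
- rewrite -setI_eq0; apply/eqP/setP => x; rewrite !inE.
  by case: (x \in A); case: (x \in cover D).
- apply/setP => x; rewrite !inE; case: (boolP (x \in A)) => [/AU->//|_] /=.
  by case: (boolP (x \in cover D)) => [/sC|] //=; rewrite inE => /andP[].
Qed.

Lemma config_parity g U A D : config g U A D -> matched g (U :\: A :\: cover D) ->
  odd #|U| = odd (#|A| + #|D|).
Proof.
move=> cf mR; have [dAC [dR ->]] := config_split cf.
have eR := matched_even mR.
rewrite (_ : #|_ :|: _| = #|A| + #|cover D| + #|U :\: A :\: cover D|); last first.
  by apply/eqP; rewrite cardsU (disjoint_setI0 dR) cards0 subn0 eqn_add2r
    cardsU (disjoint_setI0 dAC) cards0 subn0.
by rewrite !oddD (negPf eR) (config_card cf) addbF.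
Qed.

Lemma config_subset g U U' A D : U' \subset U ->
  (forall K x y, K \in D -> x \in K -> y \in U -> y \notin U' -> g x y -> y \in A) ->
  A \subset U ->
  config g U' (A :&: U') D -> config g U A D.
Proof.
move=> /subsetP sU nb AU /configP[_ tD fD sD cD]; apply/configP; split=> //.
  move=> K KD; apply/subsetP => x /(subsetP (sD K KD)); rewrite !inE.
  by case/andP => + xU; rewrite xU andbT sU // andbT.
move=> K x y KD xK yU gxy; have [yU'|yN] := boolP (y \in U').
  by have := cD K x y KD xK yU' gxy; rewrite !inE => /orP[->|/andP[->]]; rewrite ?orbT.
by rewrite in_setU (nb K x y) ?orbT.
Qed.

(** Induction through a deleted vertex v. A barrier of excess two in [U :\ v] becomes one of [U]
    when v joins [A]; if the excess is at most one, the leftover is matched and parity makes |U \ v|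
    odd. This settles an odd [U] that is not factor-critical. For even [U], either v is not adjacent
    to [D] and the barrier survives, or v is matched into a member of [D]. *)
Lemma gallai_tutte g U : symmetric g ->
  matched g U \/ exists A D, config g U A D /\ #|A| < #|D|.
Proof.
move=> gs; have [n] := ubnP #|U|; elim: n U => // n IH U ltU.
have [->|[v0 v0U]] := set_0Vmem U; first by left; apply: matched0.
have step v : v \in U -> ~~ matched g (U :\ v) ->
  (exists A D, config g U A D /\ #|A| < #|D|) \/
  exists A D, [/\ min_config g (U :\ v) A D, odd #|U :\ v|
    & matched g (U :\ v :\: A :\: cover D)].
  move=> vU nm; have cU : #|U| = #|U :\ v|.+1 by rewrite (cardsD1 v U) vU.
  have [//|[A [D [cf lt]]]] : matched g (U :\ v) \/ exists A D,
      config g (U :\ v) A D /\ #|A| < #|D| by apply: IH; lia.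
    by move=> m; rewrite m in nm.
  have [/existsP[[A2 D2] /andP[/= cf2 lt2]]|/existsPn no2] :=
    boolP [exists p : {set V} * {set {set V}},
      config g (U :\ v) p.1 p.2 && (#|p.1|.+1 < #|p.2|)].
    left; exists (v |: A2), D2; split; last first.
      by apply: leq_ltn_trans lt2; rewrite cardsU1; case: (_ \notin _).
    have /configP[A2U _ _ _ _] := cf2.
    apply: (@config_subset g U (U :\ v)).
    - exact: subD1set.
    - move=> K x y KD xK yU; rewrite !inE yU andbT negbK => /eqP-> _.
      by rewrite eqxx.
    - by rewrite subUset sub1set vU (subset_trans A2U) // subD1set.
    have -> // : (v |: A2) :&: (U :\ v) = A2.
    apply/setP => x; rewrite !inE; case: eqP => [->|_] /=.
      by apply/esym/negbTE; apply/negP => /(subsetP A2U); rewrite !inE eqxx.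
    by rewrite andb_idr // => /(subsetP A2U); rewrite inE => /andP[].
  have [A1 [D1 mc]] := min_configP cf lt; right; exists A1, D1.
  have [cf1 _] := mc; have cD := min_config_card mc.
  have mR : matched g (U :\ v :\: A1 :\: cover D1).
    have [|//|[A' [D' [cf' lt']]]] := IH (U :\ v :\: A1 :\: cover D1).
      apply: leq_ltn_trans (subset_leq_card (subsetDl _ _)) _.
      apply: leq_ltn_trans (subset_leq_card (subsetDl _ _)) _.
      by move: ltU; rewrite cU.
    have [cfc [cA' cD']] := config_cat gs cf1 cf'.
    have := no2 (A1 :|: A', D1 :|: D'); rewrite /= cfc cA' cD' cD /=.
    by case/negP; rewrite addSn ltnS ltn_add2l.
  split=> //; rewrite (config_parity cf1 mR) cD addnS /= oddD; by case: odd.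
have [fU|nfU] := boolP (fcrit g U).
  right; exists set0, [set U]; rewrite cards0 cards1; split=> //.
  apply/configP; split; rewrite ?sub0set ?trivIset1 //.
  - by move=> K /set1P->.
  - by move=> K /set1P->; rewrite setD0.
  - by move=> K x y /set1P-> _ yU _; rewrite inE yU.
have [oU|eU] := boolP (odd #|U|).
  have : exists2 v, v \in U & ~~ matched g (U :\ v).
    move: nfU; rewrite /fcrit; have -> /= : U != set0 by apply/set0Pn; exists v0.
    by case/forall_inPn => v; exists v.
  case=> v vU /(step v vU)[|[A [D [_ + _]]]]; first by right.
  by move: oU; rewrite (cardsD1 v U) vU /= => /negPf ->.
have oW : odd #|U :\ v0| by move: eU; rewrite (cardsD1 v0 U) v0U /= negbK.
have [||[A [D [mc _ mR]]]] := step v0 v0U.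
- by apply: contraL oW => /matched_even.
- by right.
have [cf _] := mc; have /configP[AU tD fD sD cD] := cf.
have [/exists_inP[K KD /exists_inP[x xK gxv]]|noadj] :=
  boolP [exists K in D, [exists x in K, g x v0]]; last first.
  right; exists A, D; split; last by rewrite (min_config_card mc).
  apply: (@config_subset g U (U :\ v0)).
  - exact: subD1set.
  - move=> K x y KD xK yU; rewrite !inE yU andbT negbK => /eqP-> gx.
    by case/exists_inP: noadj; exists K => //; apply/exists_inP; exists x.
  - by rewrite (subset_trans AU) // subD1set.
  by have -> // : A :&: (U :\ v0) = A by apply/setIidPl.
left; have [dAC [dR eU']] := config_split cf.
have mK : matched g (v0 |: K).
  apply: matched_add xK gxv => //; first exact: fD.
  by apply/negP => /(subsetP (sD K KD)); rewrite !inE eqxx andbF.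
have mrest := min_config_matched gs mc KD.
have -> : U = ((v0 |: K) :|: (A :|: cover (D :\ K))) :|: (U :\ v0 :\: A :\: cover D).
  rewrite -(setD1K v0U) [in LHS]eU' {1}(cover_setD1 KD); apply/setP => t.
  by rewrite (setD1K v0U) !in_setU; do !case: (t \in _) => //=; rewrite ?orbT.
have inC K' t : K' \in D -> t \in K' -> t \in cover D.
  by move=> K'D tK; apply/bigcupP; exists K'.
apply: matchedU => //; last apply: matchedU => //.
- rewrite -setI_eq0; apply/eqP/setP => t; rewrite [RHS]inE; apply/negP.
  rewrite in_setI => /andP[+ tR]; move: (tR); rewrite !in_setD in_set1 => /and4P[tc tA tv tU].
  case/setUP => [/setU1P[e|tK]|/setUP[tK|/bigcupP[K' /setD1P[_ K'D] tK]]].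
  + by rewrite e eqxx in tv.
  + by rewrite (inC K t) in tc.
  + by rewrite tK in tA.
  + by rewrite (inC K' t) in tc.
- rewrite -setI_eq0; apply/eqP/setP => t; rewrite [RHS]inE; apply/negP.
  rewrite in_setI => /andP[/setU1P[->|tK] /setUP[tA|/bigcupP[K' /setD1P[ne K'D] tK']]].
  + by have := subsetP AU v0 tA; rewrite !inE eqxx.
  + by have := subsetP (sD K' K'D) v0 tK'; rewrite !inE eqxx andbF.
  + by have := subsetP (sD K KD) t tK; rewrite inE tA.
  + by rewrite (config_unique cf KD K'D tK tK') eqxx in ne.
Qed.

End GallaiTutte.

(** * Deleting edges from a factor-critical graph *)

Section EdgeDeletion.
Variable V : finType.
Implicit Types (g h : rel V) (U W A B K I J : {set V}) (D X : {set {set V}}).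

Definition del g x y : rel V :=
  fun u v => [&& g u v, (u, v) != (x, y) & (u, v) != (y, x)].

Lemma del_sym g x y : symmetric g -> symmetric (del g x y).
Proof.
move=> gs u v; rewrite /del gs !xpair_eqE; congr (_ && _).
by rewrite andbC [(u == y) && _]andbC [(u == x) && _]andbC.
Qed.

Lemma delW g x y u v : del g x y u v -> g u v.
Proof. by case/andP. Qed.

Lemma delP g x y u v : g u v -> ~~ del g x y u v ->
  (u = x /\ v = y) \/ (u = y /\ v = x).
Proof.
rewrite /del => -> /=; rewrite negb_and !negbK.
by case/orP => /eqP[-> ->]; [left|right].
Qed.

(** A member of [X] is odd, so the involution sends one of its points outside, hence into [B];
    disjoint members get distinct partners. The matching may use edges of [h] that are missing in
    [g], as happens after a deletion. *)
Lemma config_count g h U A D W f X B : config g U A D -> X \subset D ->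
  pairing h W f ->
  {in X, forall K, K \subset W /\ {in K, forall z, f z \in K :|: B}} ->
  #|X| <= #|B :&: W|.
Proof.
move=> cf /subsetP sX fP XB; have /configP[_ tD fD _ _] := cf.
apply: leq_trans (leq_imset_card (fun b => pblock D (f b)) (mem (B :&: W))).
apply: subset_leq_card; apply/subsetP => K KX; have [/subsetP KW KB] := XB K KX.
have /exists_inP[z zK fzK] : [exists z in K, f z \notin K].
  rewrite -negb_forall_in; apply/negP => /forall_inP fK.
  have : matched h K by apply: (pairing_sub fP) => //; apply/subsetP.
  by move=> /matched_even; rewrite (fcrit_odd (fD K (sX K KX))).
have [fzW _ fzz _] := fP z (KW z zK).
apply/imsetP; exists (f z); last by rewrite fzz (def_pblock tD (sX K KX) zK).
by move: (KB z zK); rewrite in_setU (negPf fzK) inE fzW andbT.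
Qed.

(* Every member of [D] that a perfect matching of [U :\ a] leaves without using the
   edge [xy] takes a vertex of [A :\ a], and there are too few of these. *)
Lemma del_config g U A D x y : symmetric g -> fcrit g U ->
  config (del g x y) U A D -> #|A| < #|D| -> U \notin D ->
  [/\ A != set0, #|D| = #|A|.+1,
      exists K1 K2, [/\ K1 \in D, K2 \in D, K1 != K2, x \in K1 & y \in K2]
    & {in A, forall a, matched (del g x y) (U :\: [set a; x; y])}].
Proof.
move=> gs fU cf lt UD; have /configP[/subsetP AU tD fD sD cD] := cf.
have sDU K z : K \in D -> z \in K -> z \in U.
  by move=> KD /(subsetP (sD K KD)); rewrite inE => /andP[].
have A0 : A != set0.
  apply/eqP => A0; have [K KD] : exists K, K \in D.
    by apply/set0Pn; rewrite -card_gt0; apply: leq_ltn_trans lt.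
  (* With [A] empty, [K] can be left only along the edge xy. If that edge crosses the boundary of
     [K], then [v] is its end outside, so no matching of [U :\ v] can leave the odd set [K]. *)
  have [v [vU vK vx]] : exists v, [/\ v \in U, v \notin K &
      (x \in K -> y \in U -> y \notin K -> v = y) /\
      (y \in K -> x \in U -> x \notin K -> v = x)].
    have [/and3P[? ? yK]|n1] := boolP [&& x \in K, y \in U & y \notin K].
      by exists y; split=> //; split=> // yK'; rewrite yK' in yK.
    have [/and3P[? ? xK]|n2] := boolP [&& y \in K, x \in U & x \notin K].
      by exists x; split=> //; split=> // xK'; rewrite xK' in xK.
    have : K \proper U.
      rewrite properEneq; apply/andP; split; first by apply: contraNneq UD => <-.
      by apply/subsetP => z; apply: sDU.
    case/properP => _ [v vU vK]; exists v; split=> //; split=> h1 h2 h3.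
      by move: n1; rewrite h1 h2 h3.
    by move: n2; rewrite h1 h2 h3.
  have /matchedP[f fP] := fcrit_matched fU vU.
  suff: #|[set K]| <= #|set0 :&: (U :\ v)| by rewrite cards1 set0I cards0.
  apply: (config_count cf _ fP); first by rewrite sub1set.
  move=> _ /set1P->; have KW : K \subset U :\ v.
    by apply/subsetP => z zK; rewrite !inE (sDU K z) // andbT; apply: contraNneq vK => <-.
  split=> // z zK; have [fzW _ _ gz] := fP z (subsetP KW z zK).
  have /setD1P[fzv fzU] := fzW.
  have [gd|] := boolP (del g x y z (f z)); first by rewrite -A0; apply: cD gd.
  case/(delP gz) => -[ez ef]; rewrite in_setU; apply/orP; left; apply/negPn/negP => fK.
    by case/eqP: fzv; rewrite vx.1 // -?ez // -ef.
  by case/eqP: fzv; rewrite vx.2 // -?ez // -ef.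
have key a : a \in A -> exists f, [/\ pairing g (U :\ a) f, #|D| = #|A|.+1, f x = y, x \in U :\ a &
    exists K1 K2, [/\ K1 \in D, K2 \in D, K1 != K2, x \in K1 & y \in K2]].
  move=> aA; have /matchedP[f fP] := fcrit_matched fU (AU a aA).
  have DW K z : K \in D -> z \in K -> z \in U :\ a.
    move=> KD zK; rewrite !inE (sDU K z KD zK) andbT.
    by apply/eqP => za; have := subsetP (sD K KD) z zK; rewrite inE za aA.
  pose X := [set K in D | [forall z in K, f z \in K :|: A]].
  have sX : X \subset D by apply/subsetP => K; rewrite inE => /andP[].
  have leX : #|X| < #|A|.
    apply: leq_ltn_trans (_ : #|A :&: (U :\ a)| < _).
      apply: (config_count cf sX fP) => K; rewrite inE.
      case/andP => KD /forall_inP KA; split=> //; apply/subsetP => z; exact: DW.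
    apply: proper_card; apply/properP; split; first exact: subsetIl.
    by exists a; rewrite // !inE eqxx andbF.
  have cX : #|D :\: X| + #|X| = #|D| by rewrite cardsD (setIidPr sX) subnK ?subset_leq_card.
  have cross K : K \in D :\: X -> (x \in K /\ f x = y) \/ (y \in K /\ f y = x).
    rewrite !inE => /andP[+ KD]; rewrite KD /= => /forall_inPn[z zK fzK].
    have [fzW _ _ gz] := fP z (DW K z KD zK); have /setD1P[_ fzU] := fzW.
    have : ~~ del g x y z (f z) by apply: contra fzK => gd; apply: cD gd.
    by case/(delP gz) => -[<- <-]; [left|right].
  (* Since [#|X| < #|A| < #|D|], at least two members are left along xy. Being disjoint they are
     exactly two, one containing [x] and the other [y]. *)
  have : 1 < #|D :\: X| by move: lt leX cX; clear; lia.
  case/card_gt1P => K1 [K2 [K1X K2X ne]].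
  have [/setDP[K1D _] /setDP[K2D _]] := (K1X, K2X).
  have fxy : f x = y.
    have [[//]|[yK fy]] := cross K1 K1X.
    by have [_ _ <- _] := fP y (DW K1 y K1D yK); rewrite fy.
  have le2 : #|D :\: X| <= 2.
    have leP z : #|[set K in D :\: X | z \in K]| <= 1.
      apply/card_le1_eqP => K K' /setIdP[/setDP[KD _] zK] /setIdP[/setDP[K'D _] zK'].
      exact: (config_unique cf K'D KD zK' zK).
    apply: leq_trans (leq_add (leP x) (leP y)).
    apply: leq_trans (leq_card_setU _ _).1; apply: subset_leq_card.
    apply/subsetP => K KX; apply/setUP.
    by have [[zK _]|[zK _]] := cross K KX; [left|right]; rewrite inE KX zK.
  have xU : x \in U :\ a.
    have [[xK _]|[yK fy]] := cross K1 K1X; first exact: DW xK.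
    by have [+ _ _ _] := fP y (DW K1 y K1D yK); rewrite fy.
  exists f; split=> //; first by move: lt leX cX le2; clear; lia.
  have [[xK1 _]|[yK1 _]] := cross K1 K1X; have [[xK2 _]|[yK2 _]] := cross K2 K2X.
  - by rewrite (config_unique cf K1D K2D xK1 xK2) eqxx in ne.
  - by exists K1, K2.
  - by exists K2, K1; rewrite eq_sym.
  - by rewrite (config_unique cf K1D K2D yK1 yK2) eqxx in ne.
have [a aA] := set0Pn _ A0; have [f [_ cDA _ _ ex]] := key a aA.
split=> // b bA; have [f' [fP _ fxy xU _]] := key b bA.
have := pairingD fP xU; rewrite fxy => m.
have -> : U :\: [set b; x; y] = U :\ b :\: [set x; y].
  by apply/setP => z; rewrite !inE; case: (z == b); case: (z == x); case: (z == y).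
apply: sub_matched m => u v; rewrite !inE !negb_or => /andP[/andP[ux uy] _] _ guv.
by rewrite /del guv !xpair_eqE (negPf ux) (negPf uy).
Qed.

(** Otherwise a barrier has [x] and [y] in different members. The edges xz and yz survive, so [z]
    lies in [A], and [del_config] at [z] yields the excluded perfect matching. *)
Lemma fcrit_del g U x y z : symmetric g -> fcrit g U -> x \in U -> y \in U ->
  z \in U -> x != y -> z != x -> z != y -> g x z -> g y z ->
  ~~ matched g (U :\: [set x; y; z]) -> fcrit (del g x y) U.
Proof.
move=> gs fU xU yU zU xy zx zy gxz gyz nm.
have gs' := del_sym x y gs.
have [m|[A [D [cf lt]]]] := gallai_tutte U gs'.
  have /matched_even := sub_matched (fun u v _ _ => @delW g x y u v) m.
  by rewrite (fcrit_odd fU).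
have /configP[AU tD fD sD cD] := cf.
have [/fD//|UD] := boolP (U \in D).
have [_ _ [K1 [K2 [K1D K2D ne xK yK]]] mA] := del_config gs fU cf lt UD.
have gd u : u != z -> g u z -> del g x y u z.
  by move=> uz guz; rewrite /del guz !xpair_eqE (negPf zx) (negPf zy) !andbF.
have z1 := cD K1 x z K1D xK zU (gd x _ gxz); have z2 := cD K2 y z K2D yK zU (gd y _ gyz).
rewrite eq_sym in zx; rewrite eq_sym in zy.
have zA : z \in A.
  move: (z1 zx) (z2 zy); rewrite !in_setU => /orP[zK1|//] /orP[zK2|//].
  by rewrite (config_unique cf K1D K2D zK1 zK2) eqxx in ne.
case/negP: nm; have -> : [set x; y; z] = [set z; x; y].
  by apply/setP => t; rewrite !inE; do !case: eqP.
exact: sub_matched (fun u v _ _ => @delW g x y u v) (mA z zA).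
Qed.

(* Edges leaving [I] outside [J] lie in a bad triangle with apex in [J], so they
   can be deleted one by one; in the end [I] has no neighbour outside [J]. *)
Lemma fcrit_no_barrier g U I J : symmetric g -> fcrit g U ->
  I \subset U -> J \subset U -> [disjoint I & J] -> J != set0 -> #|J| <= #|I| ->
  (forall u v, u \in I -> v \in U -> v \notin J -> u != v -> g u v ->
     exists j, [/\ j \in J, g u j, g v j & ~~ matched g (U :\: [set u; v; j])]) ->
  False.
Proof.
have [n] := ubnP #|[set p | g p.1 p.2]|; elim: n g => // n IH g ltn gs fU sI sJ dIJ J0 le nb.
have IJ u : u \in I -> u \in J -> False.
  by move=> uI uJ; move: (disjointFr dIJ uI); rewrite uJ.
have [/exists_inP[u uI /exists_inP[v vU /and3P[uv vJ guv]]]|no] :=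
  boolP [exists u in I, [exists v in U, [&& u != v, v \notin J & g u v]]]; last first.
  have [j jJ] := set0Pn _ J0; have jU := subsetP sJ j jJ.
  (* A perfect matching of [U :\ j] now sends [I] injectively into [J :\ j], against
     [#|J| <= #|I|]. *)
  have /matchedP[f fP] := fcrit_matched fU jU.
  have IW u : u \in I -> u \in U :\ j.
    by move=> uI; rewrite !inE (subsetP sI) // andbT; apply/eqP => e; apply: (IJ u uI); rewrite e.
  suff: #|I| <= #|J :\ j| by rewrite leqNgt; apply/negP/negPn; move: le; rewrite (cardsD1 j J) jJ.
  have fi : {in I &, injective f}.
    move=> u u' uI u'I e; have [_ _ <- _] := fP u (IW u uI).
    by have [_ _ <- _] := fP u' (IW u' u'I); rewrite e.
  rewrite -(card_in_imset fi); apply: subset_leq_card; apply/subsetP => _ /imsetP[u uI ->].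
  have [/setD1P[fj fU'] fuu _ gu] := fP u (IW u uI); rewrite !inE fj /=.
  apply/negPn/negP => fJ; case/exists_inP: no; exists u => //.
  by apply/exists_inP; exists (f u); rewrite // eq_sym fuu fJ gu.
have [j [jJ guj gvj nm]] := nb u v uI vU vJ uv guv.
have uU := subsetP sI u uI; have jU := subsetP sJ j jJ.
have ju : j != u by apply: contraTneq jJ => ->; apply/negP; apply: IJ.
have jv : j != v by apply: contraNneq vJ => <-.
have fd := fcrit_del gs fU uU vU jU uv ju jv guj gvj nm.
apply: (IH (del g u v)) => //; first 1 last.
- exact: del_sym.
- move=> u' v' u'I v'U v'J ne /delW g'; have [j' [j'J gu'j gv'j nm']] := nb u' v' u'I v'U v'J ne g'.
  have aux w : g w j' -> del g u v w j'.
    move=> gw; rewrite /del gw !xpair_eqE.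
    have -> : j' == v = false by apply: contraNF vJ => /eqP <-.
    have -> : j' == u = false by apply: contraTF j'J => /eqP ->; apply/negP; apply: IJ.
    by rewrite !andbF.
  exists j'; split; rewrite ?aux //; apply: contra nm'.
  exact: sub_matched (fun _ _ _ _ => @delW _ _ _ _ _).
rewrite -ltnS; apply: leq_trans ltn; rewrite ltnS; apply: proper_card.
apply/properP; split; first by apply/subsetP => p; rewrite !inE => /delW.
by exists (u, v); rewrite !inE //= /del eqxx andbF.
Qed.

(** The barrier is taken with |D| minimal. By [del_config] no barrier has excess above one, so the
    leftover contains none and is matched; with [min_config_matched] this matches the complement of
    every member. *)
Lemma del_critical g U x y : symmetric g -> fcrit g U -> ~~ fcrit (del g x y) U ->
  exists A D,
    [/\ config (del g x y) U A D, #|D| = #|A|.+1 /\ A != set0,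
        exists K1 K2, [/\ K1 \in D, K2 \in D, K1 != K2, x \in K1 & y \in K2],
        matched (del g x y) (U :\: A :\: cover D)
      & {in D, forall K, matched (del g x y) (U :\: K)}].
Proof.
move=> gs fU nf; have gs' := del_sym x y gs.
have [m|[A0 [D0 [cf0 lt0]]]] := gallai_tutte U gs'.
  have /matched_even := sub_matched (fun u v _ _ => @delW g x y u v) m.
  by rewrite (fcrit_odd fU).
have [A [D mc]] := min_configP cf0 lt0; have [cf [lt _]] := mc.
have UnD A' D' : config (del g x y) U A' D' -> U \notin D'.
  by case/configP => _ _ fD _ _; apply: contra nf => /fD.
have [A1 cD ex _] := del_config gs fU cf lt (UnD A D cf).
have mR : matched (del g x y) (U :\: A :\: cover D).
  have [//|[A' [D' [cf' lt']]]] := gallai_tutte (U :\: A :\: cover D) gs'.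
  have [cfc [cA' cD']] := config_cat gs' cf cf'.
  have [|_ + _ _] := del_config gs fU cfc _ (UnD _ _ cfc).
    by rewrite cA' cD' cD; move: lt'; clear; lia.
  by rewrite cA' cD' cD; move: lt'; clear; lia.
exists A, D; split=> // K KD; have [dAC [dR eU]] := config_split cf.
have mK := min_config_matched gs' mc KD.
have -> : U :\: K = (A :|: cover (D :\ K)) :|: (U :\: A :\: cover D).
  have /configP[AU tD _ sD _] := cf.
  apply/setP => t; rewrite in_setD [in LHS]eU (cover_setD1 KD) !in_setU.
  have [tK|tK] /= := boolP (t \in K); last by [].
  have tc : t \in cover D by apply/bigcupP; exists K.
  rewrite in_setD (_ : (t \in _ :|: _) = true); last by rewrite -cover_setD1.
  have := subsetP (sD K KD) t tK; rewrite inE => /andP[/negPf-> _]; rewrite orbF /=.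
  apply/esym/negbTE/negP => /bigcupP[K' /setD1P[ne K'D] tK'].
  by rewrite (config_unique cf KD K'D tK tK') eqxx in ne.
apply: matchedU => //; apply: disjointWl dR.
apply: setUS; rewrite (cover_setD1 KD); exact: subsetUr.
Qed.

(** Edges outside [h] are deleted one at a time; [l] is the last factor-critical graph reached, and
    xy the edge whose deletion would break it. *)
Lemma fcrit_between g h U : symmetric g -> symmetric h -> fcrit g U ->
  subrel h g -> ~~ fcrit h U ->
  exists l x y, [/\ symmetric l, subrel h l, subrel l g, fcrit l U &
    [/\ l x y, ~~ h x y, ~~ fcrit (del l x y) U & subrel h (del l x y)]].
Proof.
have [n] := ubnP #|[set p | g p.1 p.2]|; elim: n g => // n IH g ltn gs hs fU hg nh.
have [/existsP[[x y] /andP[/= gxy nxy]]|no] := boolP [exists p : V * V, g p.1 p.2 && ~~ h p.1 p.2];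
  last first.
  case/negP: nh; apply: sub_fcrit fU => x y _ _ gxy; apply/negPn/negP => nxy.
  by case/existsP: no; exists (x, y); rewrite /= gxy.
have hd : subrel h (del g x y).
  move=> u v huv; rewrite /del hg //=; apply/andP; split.
    by apply: contraNneq nxy => -[<- <-].
  by apply: contraNneq nxy => -[<- <-]; rewrite hs.
have [fd|nd] := boolP (fcrit (del g x y) U); last by exists g, x, y; split.
have [|l [x' [y' [? ? lg ? ?]]]] := IH (del g x y) _ (del_sym x y gs) hs fd hd nh.
  rewrite -ltnS; apply: leq_trans ltn; rewrite ltnS; apply: proper_card.
  apply/properP; split; first by apply/subsetP => p; rewrite !inE => /delW.
  by exists (x, y); rewrite !inE //= /del eqxx andbF.
by exists l, x', y'; split=> // u v /lg/delW.
Qed.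

End EdgeDeletion.

(** * Weights and supports *)

Section LinearAlgebra.
Variable F : fieldType.

Lemma underdetermined (S T : finType) (X : {set S}) (Y : {set T}) (m : S -> T -> F) :
  #|Y| < #|X| ->
  exists x : S -> F,
    [/\ exists2 s, s \in X & x s != 0%R, forall s, s \notin X -> x s = 0%R
      & {in Y, forall t, \sum_(s in X) x s * m s t = 0}%R].
Proof.
move=> lt; pose M := (\matrix_(i < #|X|, j < #|Y|) m (enum_val i) (enum_val j))%R.
have : kermx M != 0%R.
  rewrite -mxrank_eq0 mxrank_ker -lt0n subn_gt0.
  exact: leq_ltn_trans (rank_leq_col M) lt.
case/rowV0Pn => u /sub_kermxP uM u0.
have {u0} [i ui] : exists i, u ord0 i != 0%R.
  apply/existsP; rewrite -negb_forall; apply: contra u0 => /forallP u0.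
  by apply/eqP/rowP => i; rewrite mxE; apply/eqP; move: (u0 i); rewrite ?negbK.
have [s0 s0X] : exists s, s \in X by exists (enum_val i); apply: enum_valP.
exists (fun s => if s \in X then u ord0 (enum_rank_in s0X s) else 0%R); split.
- by exists (enum_val i); rewrite enum_valP // enum_valK_in.
- by move=> s /negPf->.
- move=> t tY; have := congr1 (fun A : 'rV_#|Y| => A ord0 (enum_rank_in tY t)) uM.
  rewrite !mxE => uM0; apply: etrans uM0; rewrite big_enum_val.
  by apply: eq_bigr => j _; rewrite !mxE enum_valP enum_valK_in enum_rankK_in.
Qed.

End LinearAlgebra.

Section Weights.
Variables (R : realFieldType) (V : finType).
Implicit Types (g h : rel V) (U W A B K e f : {set V}) (D X : {set {set V}}).
Implicit Types (w : {set V} -> R).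
Local Open Scope ring_scope.

(** A face of size one or two counts even if it lies inside [U]: only the trace on [U] matters, so
    [w] may be replaced by its traces. *)
Definition cost w U : R := \sum_(e : {set V} | (0 < #|e :&: U| < 3)%N) w e.

(* Faces may leave [U], but adjacency and exactness are only required inside [U];
   so a weighting on [U] is one on every subset of [U]. *)
Definition weighting g w U :=
  [/\ forall e, 0 <= w e, forall e, w e != 0 -> (#|e| <= 3)%N,
      forall v, v \in U -> \sum_(e : {set V} | v \in e) w e = 1
    & forall e, w e != 0 -> {in e :&: U &, forall u v, u != v -> g u v}].

(** Together with [fcrit] this is the criticality of the overview, tested on the faces of nonzero
    weight inside [U]. *)
Definition bad g w U :=
  forall e, w e != 0 -> e \subset U -> #|e| = 3 -> ~~ matched g (U :\: e).

Definition within w U := forall e, w e != 0 -> e \subset U /\ e != set0.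

Lemma sub_weighting g h w U W : {in W &, subrel g h} -> W \subset U ->
  weighting g w U -> weighting h w W.
Proof.
move=> gh /subsetP sW [w0 w3 w1 wg]; split=> // [v /sW/w1 //|e we u v].
rewrite !inE => /andP[ue uW] /andP[ve vW] uv; apply: gh => //.
by apply: (wg e we); rewrite ?inE ?ue ?ve ?sW.
Qed.

Lemma face_config g w U A D K e x : weighting g w U -> within w U ->
  config g U A D -> K \in D -> w e != 0 -> x \in e -> x \in K -> e \subset K :|: A.
Proof.
move=> [_ _ _ wg] wU /configP[_ _ _ sD cD] KD we xe xK; have [/subsetP eU _] := wU e we.
apply/subsetP => y ye; have [<-|xy] := eqVneq x y; first by rewrite inE xK.
by apply: (cD K x y KD xK (eU y ye)); apply: (wg e we); rewrite // inE ?xe ?ye ?eU.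
Qed.

(* A face meeting [K] in [D] lies in [K :|: A]: if it is crossed by [K], it is short
   or consumes weight at [A], and at a singleton [K] it consumes twice as much. *)
Lemma config_charge g w U A D : weighting g w U -> within w U -> config g U A D ->
  {in D, forall K, #|K| != 1%N -> 3%:R / 2%:R <= cost w K} ->
  \sum_(K in D) (if #|K| == 1%N then 2%:R - w K else 3%:R / 2%:R) <=
    #|A|%:R + \sum_(e : {set V} | (#|e| < 3)%N) w e.
Proof.
move=> wt wU cf big; have [w0 w3 w1 wg] := wt; have /configP[AU tD fD sD cD] := cf.
(* Each point of [A] supplies weight 1 and each short face its own weight; [F e] is the share of [e]
   in the right-hand side. *)
pose F e := (#|e :&: A| + (#|e| < 3))%N%:R * w e.
have F0 e : 0 <= F e by rewrite mulr_ge0 ?ler0n.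
have -> : #|A|%:R + \sum_(e : {set V} | (#|e| < 3)%N) w e = \sum_e F e.
  under [RHS]eq_bigr do rewrite /F natrD mulrDl.
  rewrite big_split /=; congr (_ + _); last first.
    by rewrite big_mkcond; apply: eq_bigr => e _; case: ifP => _; rewrite ?mul1r ?mul0r.
  have -> : #|A|%:R = \sum_(a in A) \sum_(e : {set V} | a \in e) w e.
    rewrite (eq_bigr (fun=> 1)) => [|a aA]; last by apply: w1; apply: subsetP AU a aA.
    by rewrite sumr_const.
  rewrite (exchange_big_dep xpredT) //=; apply: eq_bigr => e _.
  rewrite sumr_const -[LHS]mulr_natl; congr (_%:R * _).
  by rewrite -sum1_card -[RHS]sum1_card; apply: eq_bigl => a; rewrite !inE andbC.
(* A face meeting [K] lies in [K :|: A], so it meets no other member of [D] and its share is spent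
   only once. *)
apply: (@le_trans _ _ (\sum_(K in D) \sum_(e : {set V} | e :&: K != set0) F e)); last first.
  rewrite (exchange_big_dep xpredT) //=; apply: ler_sum => e _.
  have [we|we] := eqVneq (w e) 0; first by rewrite /F we mulr0 big1.
  rewrite sumr_const -[leRHS]mulr1n; apply: ler_wpMn2l => //.
  apply/card_le1_eqP => K K'; rewrite !unfold_in /=.
  move=> /andP[KD /set0Pn[x /setIP[xe xK]]] /andP[K'D /set0Pn[y /setIP[ye yK']]].
  have := subsetP (face_config wt wU cf KD we xe xK) y ye.
  rewrite inE; have := subsetP (sD K' K'D) y yK'; rewrite inE => /andP[/negPf-> _].
  by rewrite orbF => yK; apply: (config_unique cf K'D KD yK' yK).
apply: ler_sum => K KD; have /andP[/set0Pn[d dK] _] := fD K KD.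
have dU : d \in U by have := subsetP (sD K KD) d dK; rewrite inE => /andP[].
case: ifPn => [/cards1P[d' eK]|K1].
  have {d' eK} eK : K = [set d] by move: dK; rewrite eK => /set1P->.
  rewrite lerBlDr.
  (* At a singleton, a face of size three has two points in [A], and one of size two has one such
     point and is short: both have share twice their weight. The face [K] itself has share [w K]
     only, whence the charge [2 - w K]. *)
  have <- : \sum_(e : {set V} | d \in e) 2%:R * w e = 2%:R by rewrite -mulr_sumr w1 // mulr1.
  have -> : w K = \sum_(e : {set V} | d \in e) (if e == K then w e else 0).
    by rewrite -big_mkcondr /= (big_pred1 K) // => e; rewrite andb_idl // => /eqP->.
  rewrite [X in _ <= X + _](eq_bigl (fun e => d \in e)); last first.
    move=> e; rewrite eK; apply/set0Pn/idP => [[x /setIP[xe /set1P<-]]//|de].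
    by exists d; rewrite !inE de eqxx.
  rewrite -big_split /=; apply: ler_sum => e de.
  have [we|we] := eqVneq (w e) 0; first by rewrite /F we !mulr0 add0r; case: ifP.
  have se := face_config wt wU cf KD we de dK.
  have dA : d \notin A by have := subsetP (sD K KD) d dK; rewrite inE => /andP[].
  have ce : #|e :&: A| = #|e|.-1.
    rewrite (cardsD1 d e) de /=; congr #|pred_of_set _|.
    apply/setP => x; rewrite !inE; case: (eqVneq x d) => [->|xd] /=.
      by rewrite (negPf dA) andbF.
    apply: andb_idr => xe; have := subsetP se x xe.
    by rewrite eK !inE (negPf xd).
  have we0 := w0 e; have le3 := w3 e we; have gt0 : (0 < #|e|)%N by apply/card_gt0P; exists d.
  rewrite /F ce; case: (eqVneq e K) => [eeK|neK].
    by rewrite eeK eK cards1 /= mul1r mulr2n mulrDl mul1r.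
  have : (1 < #|e|)%N.
    rewrite ltn_neqAle gt0 andbT eq_sym; apply: contra neK => /cards1P[x ex].
    by move: de; rewrite ex eK => /set1P->.
  move=> gt1; rewrite addr0 ler_wpM2r // ler_nat.
  by move: le3 gt1; case: #|e| => [|[|[|[|]]]].
apply: le_trans (big K KD K1) _.
rewrite /cost big_mkcond [leRHS]big_mkcond /=; apply: ler_sum => e _.
case: ifP => [/andP[gt0 lt3]|_]; last by case: ifP.
have ne : e :&: K != set0 by rewrite -card_gt0.
rewrite ne; have [we|we] := eqVneq (w e) 0; first by rewrite /F we mulr0.
have /set0Pn[x /setIP[xe xK]] := ne.
have se := face_config wt wU cf KD we xe xK.
rewrite -[leLHS]mul1r /F ler_wpM2r // ler1n; case: (ltnP #|e| 3) => [_|ge3]; first by rewrite addn1.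
rewrite addn0 card_gt0; apply: contraTneq lt3 => eA; rewrite -leqNgt.
have -> // : e :&: K = e; apply/setIidPl/subsetP => y ye.
have := subsetP se y ye; rewrite inE => /orP[//|yA].
by move/setP: eA => /(_ y); rewrite !inE ye yA.
Qed.

End Weights.

(** * Shadows and linear dependencies among faces *)

Section Support.
Variables (R : realFieldType) (V : finType).
Implicit Types (g h : rel V) (U W A B K e f : {set V}) (D X S : {set {set V}}).
Implicit Types (w : {set V} -> R).
Local Open Scope ring_scope.

Definition supp w := [set e | w e != 0].

(** The 2-section of the hypergraph [S]. *)
Definition shadow S : rel V :=
  fun x y => (x != y) && [exists e in S, (x \in e) && (y \in e)].

Lemma shadow_sym S : symmetric (shadow S).
Proof.
by move=> x y; rewrite /shadow eq_sym; congr (_ && _); apply: eq_existsb => e; rewrite [in RHS](andbC (y \in e)).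
Qed.

Lemma shadowP S x y :
  reflect (x != y /\ exists2 e, e \in S & (x \in e) && (y \in e)) (shadow S x y).
Proof.
by apply: (iffP andP) => -[xy] => [/exists_inP|[e eS exy]]; split=> //; apply/exists_inP; exists e.
Qed.

Lemma sub_shadow S S' : S \subset S' -> subrel (shadow S) (shadow S').
Proof.
move=> /subsetP sS x y /shadowP[xy [e /sS eS exy]]; apply/shadowP; split=> //.
by exists e.
Qed.

Lemma matched_subrel g h W : subrel g h -> matched g W -> matched h W.
Proof. by move=> gh; apply: sub_matched => x y _ _; apply: gh. Qed.

(* If the faces of [S] carried a nonzero balanced [y], the larger of its positive
   and negative parts would be separated from the rest by the other one. *)
Lemma shadow_independent S U (y : V -> R) :
  {in S, forall e, e \subset U /\ (1 < #|e| <= 3)%N} -> fcrit (shadow S) U ->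
  {in S, forall e, #|e| = 3 -> ~~ matched (shadow S) (U :\: e)} -> (#|U| != 1)%N ->
  {in S, forall e, \sum_(v in e) y v = 0} -> {in U, forall v, y v = 0}.
Proof.
move=> SU fU bS U1 yS.
pose P (z : V -> R) := [set u in U | 0 < z u].
wlog le : y yS / (#|P (fun v => - y v)| <= #|P y|)%N.
  have [le|lt] := leqP #|P (fun v => - y v)| #|P y| => wl; first exact: wl.
  have := wl (fun v => - y v); rewrite (_ : P (fun v => - - y v) = P y); last first.
    by apply/setP => u; rewrite !inE opprK.
  move=> H v vU; apply/eqP; rewrite -oppr_eq0; apply/eqP; apply: H (ltnW lt) v vU => e eS.
  by rewrite sumrN yS // oppr0.
pose I := P y; pose J := P (fun v => - y v).
have inJ v : v \in U -> (v \in J) = (y v < 0) by move=> vU; rewrite inE vU oppr_gt0.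
have nex e u : e \in S -> u \in e -> 0 < y u -> exists2 j, j \in e & y j < 0.
  move=> eS ue yu; have [/exists_inP//|/exists_inPn ge0] := boolP [exists j in e, y j < 0].
  have := yS e eS; rewrite (bigD1 u) //= => /eqP.
  rewrite paddr_eq0 ?(ltW yu) //; first by rewrite (gt_eqF yu).
  by apply: sumr_ge0 => v /andP[ve _]; rewrite leNgt ge0.
have eU e u : e \in S -> u \in e -> u \in U by move=> /SU[/subsetP sU _]; apply: sU.
have [I0 v vU|/set0Pn[u uI]] := eqVneq I set0.
  have J0 : J = set0 by apply/eqP; rewrite -cards_eq0 -leqn0 -(cards0 V) -I0.
  have vI : v \notin I by rewrite I0 inE.
  have vJ : v \notin J by rewrite J0 inE.
  move: vI vJ; rewrite inJ // inE vU /= -!leNgt => le0 ge0.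
  by apply/eqP; rewrite eq_le le0 ge0.
have /setIdP[uU yu] := uI.
exfalso; apply: (@fcrit_no_barrier V (shadow S) U I J) => //.
- exact: shadow_sym.
- by apply/subsetP => z /setIdP[].
- by apply/subsetP => z /setIdP[].
- rewrite -setI_eq0; apply/eqP/setP => z; rewrite [RHS]inE; apply/negP => /setIP[/setIdP[_ z1]].
  by case/setIdP => _; rewrite oppr_gt0 ltNge (ltW z1).
- have [z zU zu] : exists2 z, z \in U & z != u.
    have : (0 < #|U :\ u|)%N.
      by move: U1; rewrite (cardsD1 u U) uU; case: #|_ :\ _|.
    by case/card_gt0P => z /setD1P[? ?]; exists z.
  have [v [_ _ _ /shadowP[_ [e eS /andP[ue _]]]]] := fcrit_nbr fU uU zU zu.
  have [j je yj] := nex e u eS ue yu.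
  by apply/set0Pn; exists j; rewrite inJ // (eU e).
- move=> a b /setIdP[aU ya] bU; rewrite inJ // -leNgt => yb ab.
  case/shadowP => _ [e eS /andP[ae be]].
  (* A balanced face with a positive point has a negative one, which is neither [a] nor [b]. So the
     face is the triangle on [a], [b], [j], and it is bad. *)
  have [j je yj] := nex e a eS ae ya; have jU := eU e j eS je.
  have aj : a != j by apply: contraTneq yj => <-; rewrite -leNgt ltW.
  have bj : b != j by apply: contraTneq yj => <-; rewrite -leNgt.
  have e3 : e = [set a; b; j].
    have [_ /andP[_ le3]] := SU e eS.
    have c3 : #|[set a; b; j]| = 3 by rewrite -setUA cardsU1 cards2 !inE negb_or ab aj bj.
    apply/esym/eqP; rewrite eqEcard c3 le3 andbT; apply/subsetP => t.
    by rewrite !inE => /orP[/orP[]|] /eqP->.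
  have c3 : #|e| = 3 by rewrite e3 -setUA cardsU1 cards2 !inE negb_or ab aj bj.
  exists j; split; rewrite ?inJ //.
  + by apply/shadowP; split=> //; exists e; rewrite ?ae.
  + by apply/shadowP; split=> //; exists e; rewrite ?be.
  + by rewrite -e3; apply: bS.
Qed.

(** With fewer faces than points, some nonzero vector on [U] sums to zero on each of them, against
    [shadow_independent]. Singletons are discarded since they give no edge of the shadow. *)
Lemma shadow_card S U :
  {in S, forall e, e \subset U /\ (#|e| <= 3)%N} -> fcrit (shadow S) U ->
  {in S, forall e, #|e| = 3 -> ~~ matched (shadow S) (U :\: e)} -> (#|U| != 1)%N ->
  (#|U| <= #|[set e in S | (1 < #|e|)%N]|)%N.
Proof.
move=> SU fU bS U1; set S2 := [set e in S | _].
have sS2 : S2 \subset S by apply/subsetP => e /setIdP[].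
have sh : subrel (shadow S) (shadow S2).
  move=> x y /shadowP[xy [e eS /andP[xe ye]]]; apply/shadowP; split=> //.
  exists e; rewrite ?xe // inE eS /=; apply/card_gt1P; exists x, y; split=> //.
rewrite leqNgt; apply/negP => lt.
have [y [[v vU yv] _ y0]] := underdetermined (fun (v : V) (e : {set V}) => (v \in e)%:R : R) lt.
have [] : {in U, forall v, y v = 0} -> False by move=> H; rewrite H // eqxx in yv.
apply: (@shadow_independent S2 U y) => //.
- by move=> e /setIdP[eS gt]; have [? ?] := SU e eS; rewrite gt.
- by apply: sub_fcrit fU => a b _ _; apply: sh.
- move=> e /setIdP[eS _] e3; apply: contra (bS e eS e3).
  by apply: matched_subrel; apply: sub_shadow.
- move=> e eS; rewrite -[RHS](y0 e eS) [RHS](eq_bigr (fun v => if v \in e then y v else 0)).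
    rewrite -big_mkcondr /=; apply: eq_bigl => z; rewrite andb_idl // => ze.
    by move: eS => /setIdP[/SU[/subsetP sU _] _]; apply: sU.
  by move=> z _; case: (z \in e); rewrite ?mulr1 ?mulr0.
Qed.

(** More faces than points give a linear dependency [d]. Its sign is chosen so that moving along it
    does not increase the weight of short faces, and the move stops at the smallest ratio, where a
    weight vanishes. *)
Lemma reduce_support w U : (forall e, 0 <= w e) -> within w U ->
  (#|U| < #|supp w|)%N ->
  exists w', [/\ forall e, 0 <= w' e, supp w' \proper supp w,
    {in U, forall v, \sum_(e : {set V} | v \in e) w' e = \sum_(e : {set V} | v \in e) w e}
  & \sum_(e : {set V} | (#|e| < 3)%N) w' e <= \sum_(e : {set V} | (#|e| < 3)%N) w e].
Proof.
move=> w0 wU lt.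
have [d0 [[e0 e0S de0] d0S d0U]] :=
  underdetermined (fun (e : {set V}) (v : V) => (v \in e)%:R : R) lt.
pose C d : R := \sum_(e : {set V} | (#|e| < 3)%N) d e.
have [d [dn dS dU dC]] : exists d : {set V} -> R, [/\ d e0 != 0,
    forall e, e \notin supp w -> d e = 0,
    {in U, forall v, \sum_(e : {set V} | v \in e) d e = 0} & C d <= 0].
  have sumE d : (forall e, e \notin supp w -> d e = 0) -> forall v : V,
      \sum_(e in supp w) d e * (v \in e)%:R = \sum_(e : {set V} | v \in e) d e :> R.
    move=> dS v; rewrite big_mkcond [RHS]big_mkcond; apply: eq_bigr => e _.
    case: ifPn => [_|/dS->]; last by case: ifP.
    by case: ifP; rewrite ?mulr1 ?mulr0.
  have d0U' : {in U, forall v, \sum_(e : {set V} | v \in e) d0 e = 0}.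
    by move=> v vU; rewrite -sumE ?d0U.
  have [le|/ltW ge] := lerP (C d0) 0; first by exists d0.
  exists (fun e => - d0 e); split; rewrite ?oppr_eq0 //.
  - by move=> e eS; rewrite d0S ?oppr0.
  - by move=> v vU; rewrite sumrN d0U' ?oppr0.
  - by rewrite /C sumrN oppr_le0.
(* The sum of [d] over the faces at a point of [e0] is zero while [d e0] is not, so both signs
   occur. *)
have [e1 e1n] : exists e, d e < 0.
  have [/existsP//|/existsPn ge0] := boolP [exists e, d e < 0].
  have we0 : w e0 != 0 by rewrite inE in e0S.
  have [/subsetP e0U /set0Pn[v ve0]] := wU e0 we0.
  have /eqP := dU v (e0U v ve0); rewrite (bigD1 e0) //= paddr_eq0.
  - by rewrite (negPf dn).
  - by rewrite leNgt ge0.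
  - by apply: sumr_ge0 => e _; rewrite leNgt ge0.
case: (@Order.TotalTheory.arg_minP _ _ _ e1 (fun e => d e < 0) (fun e => w e / - d e) e1n) => e2 e2n mn.
set t := w e2 / - d e2.
have t0 : 0 <= t by rewrite divr_ge0 // oppr_ge0 ltW.
exists (fun e => w e + t * d e); split.
- move=> e; have [ge|en] := lerP 0 (d e); first by rewrite addr_ge0 // mulr_ge0.
  have := mn e en; rewrite -/t ler_pdivlMr ?oppr_gt0 // mulrN.
  by rewrite -subr_ge0 opprK.
- apply/properP; split.
    apply/subsetP => e; rewrite !inE; apply: contraNneq => we.
    by rewrite we dS ?mulr0 ?addr0 // inE we eqxx.
  exists e2; first by rewrite inE; apply: contraTneq e2n => we; rewrite dS ?ltxx // inE we eqxx.
  rewrite inE negbK /t; apply/eqP; have : d e2 != 0 by rewrite lt_eqF.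
  by move=> ?; field.
- by move=> v vU; rewrite big_split /= -mulr_sumr dU // mulr0 addr0.
- by rewrite big_split /= -mulr_sumr -[leRHS]addr0 lerD2l mulr_ge0_le0.
Qed.

End Support.

(** * Charging and the induction hypothesis *)

Section Star.
Variables (R : realFieldType) (V : finType).
Implicit Types (g h : rel V) (U W A B K e f : {set V}) (D X S : {set {set V}}).
Implicit Types (w : {set V} -> R).
Local Open Scope ring_scope.

Lemma sum_pred1 (P : pred {set V}) f (a : R) :
  \sum_(e | P e) (if e == f then a else 0) = if P f then a else 0.
Proof.
rewrite -big_mkcondr /=; case: ifP => Pf.
  by rewrite (big_pred1 f) // => e /=; rewrite andb_idl // => /eqP->.
by rewrite big_pred0 // => e /=; case: eqP => [->|_]; rewrite ?Pf ?andbF.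
Qed.

Definition small w : R := \sum_(e : {set V} | (#|e| < 3)%N) w e.

Definition charge w K : R := if #|K| == 1%N then 2%:R - w K else 3%:R / 2%:R.

(** The graph and the weights are quantified too, since the hypothesis is applied to graphs with
    deleted or added edges and to modified weights. *)
Definition star_below n := forall g w U, symmetric g -> weighting g w U ->
  fcrit g U -> bad g w U -> #|U| != 1%N -> (#|U| < n)%N -> 3%:R / 2%:R <= cost w U.

Lemma cost_within w U : within w U -> cost w U = small w.
Proof.
move=> wU; rewrite /cost /small big_mkcond [RHS]big_mkcond; apply: eq_bigr => e _.
have [->|we] := eqVneq (w e) 0; first by rewrite !if_same.
have [/setIidPl-> e0] := wU e we.
by rewrite card_gt0 e0.
Qed.

Section InductionStep.
Variable n : nat.
Hypothesis starn : star_below n.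

(** As [A] is nonempty, [K] is a proper subset of [U]. A perfect matching of [K] minus a face would
    extend by one of [U :\: K], so [K] inherits badness from [U]. *)
Lemma config_big g h w U A D K : (#|U| <= n)%N -> symmetric g -> subrel g h ->
  weighting g w U -> bad h w U -> config g U A D -> A != set0 ->
  K \in D -> matched g (U :\: K) -> #|K| != 1%N -> 3%:R / 2%:R <= cost w K.
Proof.
move=> Un gs gh wt bU cf /set0Pn[a aA] KD mK K1.
have /configP[AU tD fD sD cD] := cf.
have KU : K \subset U by apply: subset_trans (sD K KD) (subsetDl _ _).
apply: (starn gs) => //.
- by apply: (sub_weighting _ KU wt).
- exact: fD.
- move=> e we eK e3; apply: contra (bU e we (subset_trans eK KU) e3) => m.
  have -> : U :\: e = (K :\: e) :|: (U :\: K).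
    apply/setP => x; rewrite !inE; case: (boolP (x \in K)) => [xK|xK] /=.
      by rewrite (subsetP KU) // andbT orbF.
    by rewrite andbF /= andb_idl // => xU; apply: contra xK; apply: (subsetP eK).
  apply: (matched_subrel gh); apply: matchedU => //.
  by rewrite -setI_eq0; apply/eqP/setP => x; rewrite !inE; case: (x \in K); rewrite /= ?andbF.
- apply: leq_trans Un; apply: proper_card; apply/properP; split=> //.
  exists a; first exact: (subsetP AU).
  by apply/negP => /(subsetP (sD K KD)); rewrite inE aA.
Qed.

Lemma config_star g h w U A D : (#|U| <= n)%N -> symmetric g -> subrel g h ->
  weighting g w U -> within w U -> bad h w U -> config g U A D -> A != set0 ->
  {in D, forall K, matched g (U :\: K)} ->
  \sum_(K in D) charge w K <= #|A|%:R + small w.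
Proof.
move=> Un gs gh wt wU bU cf A0 mD; apply: (config_charge wt wU cf) => K KD K1.
exact: (config_big Un gs gh wt bU cf A0 KD (mD K KD) K1).
Qed.

(** Between the shadow and [g] there is a graph with a critical edge outside the shadow. Deleting
    that edge leaves the weighting intact, so the resulting barrier can be charged. *)
Lemma nonfcrit_cost g w U S : (#|U| <= n)%N -> symmetric g -> fcrit g U -> bad g w U ->
  subrel (shadow S) g -> supp w \subset S ->
  weighting (shadow S) w U -> within w U -> ~~ fcrit (shadow S) U ->
  3%:R / 2%:R <= small w.
Proof.
move=> Un gs fU bU Sg wS wt wU nf.
have [l [x [y [ls _ lg fl [_ _ nl Sl]]]]] := fcrit_between gs (@shadow_sym V S) fU Sg nf.
have [A [D [cf [cD A0] _ _ mD]]] := del_critical ls fl nl.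
have wtl : weighting (del l x y) w U by apply: (sub_weighting _ _ wt) => // u v _ _; apply: Sl.
have := config_star Un (del_sym x y ls) (fun u v duv => lg u v (delW duv)) wtl wU bU cf A0 mD.
have [w0 _ w1 _] := wt; have /configP[AU _ fD sD _] := cf.
rewrite (bigID (fun K => #|K| == 1%N)) /=.
rewrite (eq_bigr (fun K => 2%:R - w K)) => [|K /andP[_ K1]]; last by rewrite /charge K1.
rewrite [X in _ + X](eq_bigr (fun=> 3%:R / 2%:R)) => [|K /andP[_ /negPf K1]]; last first.
  by rewrite /charge K1.
rewrite sumrB !sumr_const -[2%:R *+ _]mulr_natr -[(3%:R / 2%:R) *+ _]mulr_natr.
set ns := #|_|; set nb := #|_|; set Sw := \sum_(K in D | _) w K.
have eN : (ns + nb = #|A| + 1)%N.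
  rewrite addn1 -cD /ns /nb -[RHS](cardID (fun K => #|K| == 1%N)); congr (_ + _)%N;
    by apply: eq_card => K; rewrite !inE; rewrite // andbC.
have Sle : Sw <= small w.
  rewrite /Sw /small big_mkcond [leRHS]big_mkcond; apply: ler_sum => K _.
  by case: ifP => [/andP[_ /eqP->]//|_]; case: ifP.
have Sns : Sw <= ns%:R.
  rewrite /ns -sum1_card natr_sum /Sw; apply: ler_sum => K /andP[KD /cards1P[d eK]].
  rewrite eK; have dU : d \in U.
    by have := subsetP (sD K KD) d; rewrite eK !inE eqxx => /(_ isT)/andP[].
  rewrite -(w1 d dU) (bigD1 [set d]) ?set11 //=.
  by rewrite lerDl sumr_ge0.
have A1 : (0 < #|A|)%N by rewrite card_gt0.
have eNR : ns%:R + nb%:R = #|A|%:R + 1 :> R by rewrite -natrD eN natrD.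
have A1R : 1 <= #|A|%:R :> R by rewrite ler1n.
have nb0 : 0 <= nb%:R :> R by rewrite ler0n.
(* The charging bound now reads ns + nb/2 + 1 <= Sw + small w. For [ns] at least 2 it is combined
   with [Sw <= small w], for smaller [ns] with [Sw <= ns]. *)
have [ns2|ns2] := leqP 2 ns.
  have : 2 <= ns%:R :> R by rewrite (ler_nat _ 2).
  lra.
have [ns1|ns1] := leqP 1 ns.
  have e1 : ns = 1%N by apply/eqP; rewrite eqn_leq ns1 -ltnS ns2.
  rewrite e1 in Sns eNR *; lra.
have e0 : ns = 0%N by apply/eqP; rewrite -leqn0 -ltnS.
rewrite e0 in Sns eNR *; lra.
Qed.

(* [star_below] is applied to [K] together with [z1] and [z2], which are joined by
   a new face carrying the weight missing at [z1]. *)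
Lemma two_labels g w U K z1 z2 : (#|U| <= n)%N -> symmetric g -> weighting g w U ->
  fcrit g K -> K \subset U -> z1 \in U -> z2 \in U -> z1 \notin K -> z2 \notin K ->
  z1 != z2 -> (exists2 x, x \in K & g x z1) -> (exists2 x, x \in K & g x z2) ->
  (forall e, w e != 0 -> e :&: K != set0 -> e \subset z1 |: (z2 |: K)) ->
  (forall e, w e != 0 -> e :&: K != set0 -> #|e| = 3 ->
     ~~ matched g ((z1 |: (z2 |: K)) :\: e)) ->
  bad g w K -> (#|K| + 2 < #|U|)%N ->
  let label z : R := \sum_(e : {set V} | (e :&: K != set0) && (z \in e)) w e in
  label z2 <= label z1 ->
  1 / 2%:R + label z2 <= \sum_(e : {set V} | (e :&: K != set0) && (#|e| < 3)%N) w e.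
Proof.
move=> Un gs [w0 w3 w1 wg] fK KU z1U z2U z1K z2K z12 a1 a2 sU' b2 bK lt label le.
have l1 : label z1 <= 1.
  by rewrite -(w1 z1 z1U) /label big_andbC /= big_mkcondr; apply: ler_sum => e _; case: ifP.
pose U' := z1 |: (z2 |: K).
pose g' x y := [|| g x y, (x == z1) && (y == z2) | (x == z2) && (y == z1)].
have gg' : subrel g g' by move=> x y gxy; rewrite /g' gxy.
(* The pair carries what [z1] lacks and the singleton supplies the rest at [z2], which is
   nonnegative as [label z2 <= label z1]. Together they cost [1 - label z2], so a total of 3/2
   leaves [1/2 + label z2] for the short faces meeting [K]. *)
pose w' e := (if e :&: K != set0 then w e else 0) +
  ((if e == [set z1; z2] then 1 - label z1 else 0) +
   (if e == [set z2] then label z1 - label z2 else 0)).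
have sumw' (P : pred {set V}) : \sum_(e | P e) w' e =
    \sum_(e | P e && (e :&: K != set0)) w e +
    ((if P [set z1; z2] then 1 - label z1 else 0) +
     (if P [set z2] then label z1 - label z2 else 0)).
  by rewrite !big_split /= !sum_pred1 -big_mkcondr.
have w'P e : w' e != 0 -> [\/ w e != 0 /\ e :&: K != set0, e = [set z1; z2] | e = [set z2]].
  rewrite /w'; case: (eqVneq e [set z1; z2]) => [->|_]; first by move=> _; apply: Or32.
  case: (eqVneq e [set z2]) => [->|_]; first by move=> _; apply: Or33.
  by rewrite !addr0; case: ifP => [ne we|_]; [apply: Or31|rewrite eqxx].
have gs' : symmetric g'.
  by move=> x y; rewrite /g' gs; congr (_ || _); rewrite orbC andbC [X in _ || X]andbC.
have cU' : #|U'| = (#|K| + 2)%N by rewrite /U' !cardsU1 !inE negb_or z12 z1K z2K /= addn2.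
have wt' : weighting g' w' U'.
  split.
  - move=> e; rewrite /w' !addr_ge0 //; first by case: ifP.
      by case: ifP; rewrite // subr_ge0.
    by case: ifP; rewrite // subr_ge0.
  - by move=> e /w'P[[/w3]|->|->] //; rewrite ?cards1 ?cards2 ?z12.
  - move=> v vU'; rewrite sumw' !inE; case/setU1P: vU' => [->|/setU1P[->|vK]].
    + rewrite eqxx (negPf z12) /= addr0 (eq_bigl (fun e => (e :&: K != set0) && (z1 \in e))).
        by rewrite -/(label z1) addrC subrK.
      by move=> e; rewrite andbC.
    + rewrite eqxx orbT (eq_bigl (fun e => (e :&: K != set0) && (z2 \in e))).
        by rewrite -/(label z2); ring.
      by move=> e; rewrite andbC.
    + have -> : (v == z1) = false by apply: contraTF vK => /eqP->.
      have -> : (v == z2) = false by apply: contraTF vK => /eqP->.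
      rewrite !addr0 -(w1 v (subsetP KU v vK)); apply: eq_bigl => e.
      by apply: andb_idr => ve; apply/set0Pn; exists v; rewrite inE ve.
  - move=> e /w'P[[we ne]|->|->] u v.
    + rewrite !inE => /andP[ue uU'] /andP[ve vU'] uv; apply: gg'; apply: (wg e we) => //.
        by rewrite inE ue; case/or3P: uU' => [/eqP->|/eqP->|/(subsetP KU)].
      by rewrite inE ve; case/or3P: vU' => [/eqP->|/eqP->|/(subsetP KU)].
    + rewrite !inE => /andP[/orP[]/eqP-> _] /andP[/orP[]/eqP-> _]; rewrite ?eqxx //.
        by rewrite /g' !eqxx orbT.
      by rewrite /g' !eqxx !orbT.
    + by rewrite !inE => /andP[/eqP-> _] /andP[/eqP->]; rewrite eqxx.
have fU' : fcrit g' U'.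
  apply: fcrit_ear => //.
  - by apply: sub_fcrit fK => x y _ _; apply: gg'.
  - by rewrite /g' !eqxx orbT.
  - by case: a1 => x ? ?; exists x => //; apply: gg'.
  - by case: a2 => x ? ?; exists x => //; apply: gg'.
have bU' : bad g' w' U'.
  move=> e we eU' e3; have [we0 ne] : w e != 0 /\ e :&: K != set0.
    by case: (w'P e we) => // ee; move: e3; rewrite ee ?cards1 ?cards2 ?z12.
  apply/negP => /matchedP[f fP].
  (* If the matching uses the new edge, then [e] lies in [K] and removing that edge leaves a
     matching of [K :\: e] in [g]; otherwise all its edges are old. *)
  have [/andP[/andP[z1e z2e] /eqP fz]|nz] :=
    boolP ((z1 \notin e) && (z2 \notin e) && (f z1 == z2)).
    have eK : e \subset K.
      apply/subsetP => x xe; have := subsetP eU' x xe; rewrite !inE.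
      case/or3P => // /eqP ex; first by rewrite -ex xe in z1e.
      by rewrite -ex xe in z2e.
    case/negP: (bK e we0 eK e3).
    have z1W : z1 \in U' :\: e by rewrite !inE eqxx andbT.
    have := pairingD fP z1W; rewrite fz.
    have -> : U' :\: e :\: [set z1; z2] = K :\: e.
      apply/setP => x; rewrite !inE; case: (eqVneq x z1) => [->|_] /=.
        by rewrite (negPf z1K) andbF.
      by case: (eqVneq x z2) => [->|_] //=; rewrite (negPf z2K) andbF.
    apply: sub_matched => x y; rewrite !inE => /andP[_ xK] /andP[_ yK].
    have xz z : z \notin K -> (x == z) = false by move=> zK; apply: contraNF zK => /eqP<-.
    by rewrite /g' !xz //= orbF.
  case/negP: (b2 e we0 ne e3); apply/matchedP; exists f => x xW.
  have [fxW fxx fxK] := fP x xW; rewrite /g' => /or3P[gx //|/andP[/eqP ex /eqP ef]|/andP[/eqP ex /eqP ef]].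
    by case/negP: nz; move: xW fxW; rewrite ex in ef *; rewrite ef eqxx !inE => /andP[-> _] /andP[-> _].
  case/negP: nz; move: xW fxW; rewrite ef ex !inE => /andP[-> _] /andP[-> _].
  by rewrite -ef fxK ex eqxx.
have := starn gs' wt' fU' bU'; rewrite cU' /cost sumw' addn2.
move=> /(_ isT (leq_trans _ Un)); rewrite -addn2 => /(_ lt).
have -> : [set z1; z2] :&: U' = [set z1; z2].
  by apply/setIidPl/subsetP => x; rewrite !inE => /orP[]->; rewrite ?orbT.
have -> : [set z2] :&: U' = [set z2].
  by apply/setIidPl/subsetP => x; rewrite !inE => ->; rewrite orbT.
rewrite cards1 cards2 z12 /=.
set c1 := \sum_(e | _) w e; set c2 := \sum_(e | _) w e.
have -> : c1 = c2.
  rewrite /c1 /c2 big_mkcond [RHS]big_mkcond; apply: eq_bigr => e _.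
  have [->|we] := eqVneq (w e) 0; first by rewrite !if_same.
  rewrite andbC; case: (boolP (e :&: K != set0)) => //= ne.
  have /setIidPl-> := sU' e we ne; rewrite (_ : (0 < #|e|)%N) //.
  by rewrite card_gt0; apply: contra ne => /eqP->; rewrite set0I.
lra.
Qed.

End InductionStep.

End Star.

(** * Spreading a face over its points *)

Section Split.
Variables (R : realFieldType) (V : finType).
Implicit Types (g h : rel V) (U W A B K e f : {set V}) (D X S : {set {set V}}).
Implicit Types (w : {set V} -> R).
Local Open Scope ring_scope.

(** Each point of [f] receives, as a singleton, the weight of [f]. All vertex sums are kept, while a
    larger [f] no longer forces edges of the graph. *)
Definition spread w f e : R :=
  (if e == f then 0 else w e) + (if (#|e| == 1%N) && (e \subset f) then w f else 0).

Lemma spread_supp w f e : spread w f e != 0 ->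
  (w e != 0 /\ e != f) \/ (#|e| = 1%N /\ e \subset f).
Proof.
rewrite /spread; case: (eqVneq e f) => [_|ne].
  by rewrite add0r; case: ifP => [/andP[/eqP ? ?]|]; [right|rewrite eqxx].
case: ifP => [/andP[/eqP ? ?]|_]; first by right.
by rewrite addr0; left.
Qed.

Lemma spread_weighting g h w U f : weighting g w U -> f \subset U ->
  (forall e, w e != 0 -> e != f -> {in e :&: U &, forall u v, u != v -> h u v}) ->
  weighting h (spread w f) U.
Proof.
move=> [w0 w3 w1 wg] fU nh; split.
- by move=> e; rewrite /spread addr_ge0 //; case: ifP.
- by move=> e /spread_supp[[/w3]|[->]].
- move=> v vU; rewrite big_split /= -big_mkcondr /= -[RHS](w1 v vU).
  have -> : \sum_(e : {set V} | v \in e) (if e == f then 0 else w e) =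
      \sum_(e : {set V} | (v \in e) && (e != f)) w e.
    by rewrite [RHS]big_mkcondr; apply: eq_bigr => e _; case: eqP.
  have [vf|vf] := boolP (v \in f).
    rewrite [RHS](bigD1 f) //= addrC; congr (_ + _).
    rewrite (big_pred1 [set v]) // => e /=; apply/and3P/eqP => [[ve /cards1P[z ez] _]|->].
      by move: ve; rewrite ez => /set1P->.
    by rewrite inE cards1 sub1set.
  rewrite [X in _ + X]big_pred0 ?addr0.
    by apply: eq_bigl => e; apply: andb_idr => ve; apply: contraNneq vf => <-.
  by move=> e; apply/negbTE/negP => /and3P[ve _ /subsetP/(_ v ve)]; rewrite (negPf vf).
- move=> e /spread_supp[[we ne]|[/eqP/cards1P[z ->] _]]; first exact: nh.
  by move=> u v; rewrite !inE => /andP[/eqP-> _] /andP[/eqP-> _]; rewrite eqxx.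
Qed.

Lemma spread_within w U f : within w U -> f \subset U -> within (spread w f) U.
Proof.
move=> wU fU e /spread_supp[[/wU//]|[e1 ef]].
by split; [apply: subset_trans fU|rewrite -card_gt0 e1].
Qed.

Lemma spread_bad g w U f : bad g w U -> bad g (spread w f) U.
Proof. by move=> bU e /spread_supp[[we _]|[-> _]] //; apply: bU. Qed.

Lemma small_spread w f :
  small (spread w f) = small w - (if (#|f| < 3)%N then w f else 0) + #|f|%:R * w f.
Proof.
rewrite /small big_split /=; congr (_ + _); last first.
  rewrite -big_mkcondr /= mulr_natl.
  rewrite (eq_bigl (fun e => e \in [set e : {set V} | (e \subset f) & #|e| == 1%N])).
    by rewrite sumr_const cards_draws bin1.
  by move=> e; rewrite inE; case: (#|e| =P 1%N) => [->|_]; rewrite ?andbT ?andbF.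
rewrite -(sum_pred1 (fun e : {set V} => (#|e| < 3)%N) f (w f)) -sumrB.
by apply: eq_bigr => e _; case: (eqVneq e f) => [->|_]; rewrite ?subrr ?subr0.
Qed.

Lemma spread_set1 w f d : w [set d] = 0 -> (1 < #|f|)%N ->
  spread w f [set d] = if d \in f then w f else 0.
Proof.
move=> wd f1; rewrite /spread wd if_same add0r cards1 sub1set.
by [].
Qed.

End Split.

(** * The minimal counterexample *)

Section Minimal.
Variables (R : realFieldType) (V : finType).
Implicit Types (g h : rel V) (A B K e f : {set V}) (D X : {set {set V}}).
Local Open Scope ring_scope.
Variables (n : nat) (w : {set V} -> R) (U : {set V}).
Hypothesis starn : star_below R V n.
Let H := shadow (supp w).
Hypothesis Un : (#|U| <= n)%N.
Hypothesis wU : within w U.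
Hypothesis wt : weighting H w U.
Hypothesis fU : fcrit H U.
Hypothesis bU : bad H w U.
Hypothesis b_lt : small w < 3%:R / 2%:R.
Hypothesis sz : forall e, w e != 0 -> (1 < #|e|)%N.
Hypothesis crit : forall f, w f != 0 -> ~~ fcrit (shadow (supp w :\ f)) U.
Hypothesis cS : #|supp w| = #|U|.

Let w0 e : 0 <= w e. Proof. by case: wt. Qed.
Let w3 e : w e != 0 -> (#|e| <= 3)%N. Proof. by case: wt => _ + _ _; apply. Qed.
Let w1 v : v \in U -> \sum_(e : {set V} | v \in e) w e = 1.
Proof. by case: wt => _ _ + _; apply. Qed.
Let Hs : symmetric H. Proof. exact: shadow_sym. Qed.
Let eU e : w e != 0 -> e \subset U. Proof. by case/wU. Qed.

Lemma two_faces v e f : v \in U -> v \in e -> v \in f -> e != f -> w e + w f <= 1.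
Proof.
move=> vU ve vf ef; rewrite -(w1 vU) (bigD1 e) //= (bigD1 f) /=; last by rewrite vf eq_sym.
by rewrite addrA lerDl sumr_ge0.
Qed.

(** After spreading, the remaining faces respect the graph without xy, so the barrier created by
    deleting xy can be charged. Badness is still measured in [H]. *)
Lemma spread_config f l x y : w f != 0 -> symmetric l -> subrel l H -> fcrit l U ->
  ~~ fcrit (del l x y) U -> subrel (shadow (supp w :\ f)) (del l x y) ->
  exists A D,
    [/\ config (del l x y) U A D, #|D| = #|A|.+1 /\ A != set0,
        exists K1 K2, [/\ K1 \in D, K2 \in D, K1 != K2, x \in K1 & y \in K2],
        matched (del l x y) (U :\: A :\: cover D)
      & {in D, forall K, matched (del l x y) (U :\: K)}] /\
    \sum_(K in D) charge (spread w f) K <= #|A|%:R + small (spread w f).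
Proof.
move=> wf ls lH fl nl sl; have [A [D [cf cD ex mR mD]]] := del_critical ls fl nl.
exists A, D; split=> //.
have wts : weighting (del l x y) (spread w f) U.
  apply: (spread_weighting wt (eU wf)) => e we ef u v /setIP[ue _] /setIP[ve _] uv.
  by apply: sl; apply/shadowP; split=> //; exists e; rewrite ?ue // !inE ef.
apply: (config_star (h := H) starn Un (del_sym x y ls) _ wts _ _ cf) => //.
- by move=> u v /delW; apply: lH.
- exact: (spread_within wU (eU wf)).
- exact: (spread_bad bU).
- by case: cD.
Qed.

Lemma sum_card_faces : \sum_(e in supp w) #|e|%:R * w e = #|U|%:R.
Proof.
have -> : #|U|%:R = \sum_(v in U) \sum_(e : {set V} | v \in e) w e.
  rewrite (eq_bigr (fun=> 1)) => [|v /w1//]; by rewrite sumr_const.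
rewrite (exchange_big_dep xpredT) //= [LHS]big_mkcond; apply: eq_bigr => e _.
rewrite inE; have [->|we] := eqVneq (w e) 0; first by rewrite big1.
rewrite sumr_const -[RHS]mulr_natl; congr (_%:R * _).
rewrite -sum1_card -[RHS]sum1_card; apply: eq_bigl => v.
by rewrite [RHS]unfold_in /= andb_idl //; apply: (subsetP (eU we)).
Qed.

(* Otherwise all faces have size three and average weight 1/3; spreading a face of
   weight at most 1/3 contradicts the charging bound. *)
Lemma pair_exists : exists2 p, w p != 0 & #|p| = 2.
Proof.
have [/existsP[p /andP[wp /eqP p2]]|/existsPn no] :=
  boolP [exists p : {set V}, (w p != 0) && (#|p| == 2)]; first by exists p.
have all3 e : w e != 0 -> #|e| = 3.
  move=> we; have := no e; rewrite we /= => n2; apply/eqP.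
  by rewrite eqn_leq w3 //= ltn_neqAle eq_sym n2 sz.
have b0 : small w = 0.
  apply: big1 => e lt; apply/eqP; apply/negPn/negP => /all3 e3.
  by rewrite e3 in lt.
have [t tS t3] : exists2 t, t \in supp w & w t <= 1 / 3%:R.
  have [/exists_inP//|/exists_inPn gt] := boolP [exists t in supp w, w t <= 1 / 3%:R].
  have gt' e : e \in supp w -> 1 / 3%:R < w e by move=> /gt; rewrite -ltNge.
  have /card_gt0P[e0 e0S] : (0 < #|supp w|)%N.
    by rewrite cS card_gt0; case/andP: fU.
  have : \sum_(e in supp w) 1 < \sum_(e in supp w) #|e|%:R * w e.
    apply: ltr_sum; first by apply/hasP; exists e0; rewrite ?mem_index_enum.
    move=> e eS; have := gt' e eS; rewrite inE in eS; rewrite (all3 e eS); lra.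
  by rewrite sum_card_faces sumr_const cS ltxx.
have wt0 : w t != 0 by rewrite inE in tS.
have sH : subrel (shadow (supp w :\ t)) H by apply: sub_shadow; apply: subD1set.
have [l [x [y [ls _ lH fl [_ _ nl sl]]]]] :=
  fcrit_between Hs (@shadow_sym V (supp w :\ t)) fU sH (crit wt0).
have [A [D [[cf [cD A0] _ _ _] le]]] := spread_config wt0 ls lH fl nl sl.
move: le; rewrite small_spread b0 (all3 t wt0) /= subr0 add0r.
(* A singleton is charged at least 2 - 1/3, so every charge is at least 3/2. Hence 3/2 (|A| + 1) <=
   |A| + 3 w t <= |A| + 1, which is absurd. *)
have : \sum_(K in D) 3%:R / 2%:R <= \sum_(K in D) charge (spread w t) K :> R.
  apply: ler_sum => K KD; rewrite /charge; case: ifP => // /cards1P[d ->].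
  have wd : w [set d] = 0.
    by apply/eqP; apply/negPn/negP => /sz; rewrite cards1.
  rewrite spread_set1 ?(all3 t) //; case: ifP => _; lra.
rewrite sumr_const cD -[_ *+ _]mulr_natr -addn1 natrD.
have : 0 <= #|A|%:R :> R by rewrite ler0n.
lra.
Qed.

(** * The barrier left by deleting a face of size two *)

Section Pair.
Variables (p : {set V}) (G : rel V) (A : {set V}) (D : {set {set V}}).
Hypothesis wp : w p != 0.
Hypothesis p2 : #|p| = 2.
Hypothesis Gs : symmetric G.
Hypothesis GH : subrel G H.
Hypothesis HG : forall u v, H u v -> ~~ G u v -> u \in p /\ v \in p.
Hypothesis faceG : forall e, w e != 0 -> e != p -> {in e &, forall u v, u != v -> G u v}.
Hypothesis cf : config G U A D.
Hypothesis mR : matched G (U :\: A :\: cover D).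
Hypothesis mD : {in D, forall K, matched G (U :\: K)}.

Let AU : A \subset U. Proof. by case/configP: cf. Qed.
Let fD K : K \in D -> fcrit G K. Proof. by case/configP: cf => _ _ + _ _; apply. Qed.
Let sD K : K \in D -> K \subset U :\: A. Proof. by case/configP: cf => _ _ _ + _; apply. Qed.
Let DU K : K \in D -> K \subset U.
Proof. by move=> KD; apply: subset_trans (sD KD) (subsetDl _ _). Qed.
Let DA K t : K \in D -> t \in K -> t \notin A.
Proof. by move=> KD /(subsetP (sD KD)) /setDP[]. Qed.

Lemma face_in K e z : K \in D -> w e != 0 -> e != p -> z \in e -> z \in K ->
  e \subset K :|: A.
Proof.
move=> KD we ep ze zK; apply/subsetP => t te.
have [<-|zt] := eqVneq z t; first by rewrite inE zK.
case/configP: cf => _ _ _ _ cl; apply: (cl K z t KD zK); first exact: (subsetP (eU we)).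
exact: (faceG we ep).
Qed.

Lemma comp_fcrit K : K \in D -> fcrit H K.
Proof. by move=> /fD; apply: sub_fcrit => u v _ _; apply: GH. Qed.

Lemma comp_bad K : K \in D -> bad H w K.
Proof.
move=> KD e we eK e3; apply: contra (bU we (subset_trans eK (DU KD)) e3) => m.
have -> : U :\: e = (K :\: e) :|: (U :\: K).
  apply/setP => x; rewrite !inE; case: (boolP (x \in K)) => [xK|xK] /=.
    by rewrite (subsetP (DU KD)) // andbT orbF.
  by rewrite andbF /= andb_idl // => xU; apply: contra xK; apply: (subsetP eK).
apply: matchedU => //; last exact: matched_subrel GH (mD KD).
by rewrite -setI_eq0; apply/eqP/setP => x; rewrite !inE; case: (x \in K); rewrite /= ?andbF.
Qed.

Lemma comp_cost K : K \in D -> A != set0 -> #|K| != 1%N -> 3%:R / 2%:R <= cost w K.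
Proof.
move=> KD /set0Pn[a aA] K1; apply: (starn Hs) => //.
- by apply: (sub_weighting _ (DU KD) wt).
- exact: comp_fcrit.
- exact: comp_bad.
- apply: leq_trans Un; apply: proper_card; apply/properP; split; first exact: DU.
  exists a; first exact: (subsetP AU).
  by apply: contraL aA => /(DA KD).
Qed.

(** A perfect matching of [U :\ a] must leave the odd set [K]. Leaving along [p] would put [a] in
    [p], both of whose ends are matched; so the edge leads to [A]. *)
Lemma comp_exit K a : K \in D -> a \in U -> a \notin K ->
  (forall t, t \in p -> t \in K -> a \in p) ->
  exists z b, [/\ z \in K, b \in A, b != a & H z b].
Proof.
move=> KD aU aK pK; have /matchedP[f fP] := fcrit_matched fU aU.
have KW : K \subset U :\ a.
  apply/subsetP => t tK; rewrite !inE (subsetP (DU KD)) // andbT.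
  by apply: contraNneq aK => <-.
have /exists_inP[z zK fzK] : [exists z in K, f z \notin K].
  rewrite -negb_forall_in; apply/negP => /forall_inP fK.
  have : matched H K by apply: (pairing_sub fP).
  by move=> /matched_even; rewrite (fcrit_odd (fD KD)).
have [/setD1P[fza fzU] fzz _ gz] := fP z (subsetP KW z zK).
exists z, (f z); split=> //.
have [gG|nG] := boolP (G z (f z)).
  case/configP: cf => _ _ _ _ cl; have := cl K z (f z) KD zK fzU gG.
  by rewrite inE (negPf fzK).
have [zp fp] := HG gz nG.
have ap := pK z zp zK.
have : p \subset [set z; f z].
  rewrite subEproper; apply/orP; left; rewrite eq_sym eqEcard p2 cards2.
  by rewrite eq_sym fzz /= andbT; apply/subsetP => t; rewrite !inE => /orP[]/eqP->.
move/subsetP/(_ a ap); rewrite !inE => /orP[/eqP az|/eqP af]; last by rewrite -af eqxx in fza.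
by rewrite az zK in aK.
Qed.

Let label K z : R := \sum_(e : {set V} | (e :&: K != set0) && (z \in e)) w e.
Let short K : R := \sum_(e : {set V} | (e :&: K != set0) && (#|e| < 3)%N) w e.

(** Faces meeting [K] stay within [K], [a] and [z'], so [two_labels] applies to these two points. As
    [p] is the only pair meeting [K], both [label K z'] and [short K] equal [w p]. *)
Lemma one_apex K K' z z' a : K \in D -> K' \in D -> K != K' -> z \in K -> z' \in K' ->
  p = [set z; z'] -> A = [set a] -> #|D| = 2 -> #|K| != 1%N -> #|K'| != 1%N ->
  (forall e, w e != 0 -> #|e| = 2 -> e != p -> e :&: K = set0) -> w p < 1 -> False.
Proof.
move=> KD K'D KK' zK z'K' ep eA D2 K1 K'1 nopair wp1.
have disj t : t \in K -> t \in K' -> False.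
  by move=> tK tK'; move/eqP: KK'; apply; apply: (config_unique cf KD K'D tK tK').
have aA : a \in A by rewrite eA inE.
have aU : a \in U by apply: (subsetP AU).
have aK : a \notin K by apply: contraL aA => /(DA KD).
have aK' : a \notin K' by apply: contraL aA => /(DA K'D).
have z'K : z' \notin K by apply/negP => z'K; apply: (disj z').
have z'U : z' \in U by apply: (subsetP (DU K'D)).
have az' : a != z' by apply: contraNneq aK' => ->.
have eD : D = [set K; K'].
  apply/esym/eqP; rewrite eqEcard D2 cards2 KK' andbT.
  by apply/subsetP => X; rewrite !inE => /orP[]/eqP->.
have cov t : (t \in cover D) = (t \in K) || (t \in K').
  by rewrite eD /cover bigcup_setU !big_set1 inE.
have sub e : w e != 0 -> e :&: K != set0 -> e \subset a |: (z' |: K).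
  move=> we /set0Pn[t /setIP[te tK]]; have [->|eNp] := eqVneq e p.
    by rewrite ep; apply/subsetP => u; rewrite !inE => /orP[]/eqP->; rewrite ?zK ?eqxx ?orbT.
  apply: subset_trans (face_in KD we eNp te tK) _; rewrite eA.
  by apply/subsetP => u; rewrite !inE => /orP[]->; rewrite ?orbT.
have bad2 e : w e != 0 -> e :&: K != set0 -> #|e| = 3 ->
    ~~ matched H ((a |: (z' |: K)) :\: e).
  move=> we ne e3; apply: contra (bU we (eU we) e3) => m.
  have se : e \subset a |: K.
    have /set0Pn[t /setIP[te tK]] := ne.
    have eNp : e != p by apply/eqP => ee; move: e3; rewrite ee p2.
    by apply: subset_trans (face_in KD we eNp te tK) _; rewrite eA setUC.
  have -> : U :\: e = ((a |: (z' |: K)) :\: e) :|: ((K' :\ z') :|: (U :\: A :\: cover D)).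
    apply/setP => t; rewrite !in_setU !in_setD cov eA !in_set1.
    have [te|te] /= := boolP (t \in e).
      have := subsetP se t te; rewrite !inE => /orP[/eqP->|tK].
        by rewrite eqxx (negPf aK') !andbF.
      rewrite tK /= orbF; apply/esym/negbTE/negP => /andP[_]; exact: disj.
    rewrite !inE; have [->|ta] := eqVneq t a; first by rewrite aU.
    have [->|tz] := eqVneq t z'; first by rewrite z'U.
    have [tK|tK] /= := boolP (t \in K); first by rewrite (subsetP (DU KD)).
    by have [tK'|tK'] /= := boolP (t \in K'); first by rewrite (subsetP (DU K'D)).
  apply: matchedU => //; last apply: matchedU => //.
  - rewrite -setI_eq0; apply/eqP/setP => t; rewrite [RHS]inE; apply/negP.
    rewrite !inE cov eA inE => /andP[/andP[_ /or3P[/eqP->|/eqP->|tK]]].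
    + by rewrite eqxx (negPf aK') /= !andbF.
    + by rewrite eqxx z'K' /= orbT.
    + by rewrite tK /= ?andbF orbF => /andP[_]; exact: disj.
  - rewrite -setI_eq0; apply/eqP/setP => t; rewrite [RHS]inE; apply/negP.
    by rewrite !inE cov => /andP[/andP[_ ->]]; rewrite orbT.
  - by apply: matched_subrel GH _; apply: fcrit_matched (fD K'D) z'K'.
  - exact: matched_subrel GH mR.
have lt : (#|K| + 2 < #|U|)%N.
  have c3 : (2 < #|K'|)%N.
    by have := fcrit_odd (fD K'D); move: K'1; case: #|K'| => [|[|[|]]].
  have : (#|K'| <= #|U :\: K :\ a|)%N.
    apply: subset_leq_card; apply/subsetP => t tK'; rewrite !inE (subsetP (DU K'D)) //.
    rewrite andbT; apply/andP; split; first by apply: contraNneq aK' => <-.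
    by apply/negP => tK; apply: (disj t).
  have := cardsD1 a (U :\: K); rewrite !inE aK aU /= cardsD (setIidPr (DU KD)).
  by have := subset_leq_card (DU KD); move: c3; clear; lia.
have Hz : H z z'.
  apply/shadowP; split; first by apply: contraNneq z'K => <-.
  by exists p; rewrite ?inE // ep !inE !eqxx orbT.
have [u [b [uK]]] : exists u b, [/\ u \in K, b \in A, b != z' & H u b].
  by apply: (comp_exit KD z'U z'K) => t _ _; rewrite ep !inE eqxx orbT.
rewrite eA => /set1P-> _ Hua.
have Kstar := comp_cost KD (_ : A != set0) K1.
have {Kstar} : 3%:R / 2%:R <= cost w K.
  by apply: Kstar; apply/set0Pn; exists a.
have short_p : short K = w p.
  rewrite /short (bigD1 p) /=; last first.
    by rewrite p2 andbT; apply/set0Pn; exists z; rewrite !inE zK ep !inE eqxx.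
  rewrite big1 ?addr0 // => e /andP[/andP[/negP ne lt3] eNp]; apply/eqP.
  apply/negPn/negP => we; apply: ne; rewrite nopair //.
  by have := sz we; move: lt3; case: #|e| => [|[|[|]]].
have label_p : label K z' = w p.
  rewrite /label (bigD1 p) /=; last first.
    by rewrite {2}ep !inE eqxx orbT andbT; apply/set0Pn; exists z; rewrite !inE zK ep !inE eqxx.
  rewrite big1 ?addr0 // => e /andP[/andP[/set0Pn[t /setIP[te tK]] z'e] eNp]; apply/eqP.
  apply/negPn/negP => we; have := subsetP (face_in KD we eNp te tK) z' z'e.
  by rewrite eA !inE (negPf z'K) eq_sym (negPf az').
have cost_le : cost w K <= short K + label K a.
  rewrite /cost /short /label big_mkcond [X in _ <= X + _]big_mkcond [X in _ <= _ + X]big_mkcond /=.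
  rewrite -big_split /=; apply: ler_sum => e _.
  have we0 := w0 e; case: ifP => [/andP[gt0 lt3]|_]; last by rewrite addr_ge0 //; case: ifP.
  have ne : e :&: K != set0 by rewrite -card_gt0.
  rewrite ne /=; have [->|we] := eqVneq (w e) 0; first by rewrite !if_same addr0.
  case: (ltnP #|e| 3) => [_|ge3]; first by rewrite lerDl; case: ifP.
  have -> : a \in e.
    apply: contraTT lt3 => ae; rewrite -leqNgt; apply: (leq_trans ge3).
    have eNp : e != p by apply: contraTneq ge3 => ->; rewrite p2.
    have /set0Pn[t /setIP[te tK]] := ne; apply: subset_leq_card; rewrite subsetI subxx.
    apply/subsetP => v ve; have := subsetP (face_in KD we eNp te tK) v ve.
    by rewrite eA !inE => /orP[//|/eqP va]; rewrite -va ve in ae.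
  by rewrite add0r.
(* If [z'] has the smaller label, then 1/2 + w p <= w p. Otherwise [label K a] is at most w p - 1/2,
   and 3/2 <= cost w K <= w p + label K a forces w p >= 1. *)
have [le|/ltW le] := lerP (label K z') (label K a).
  have := two_labels starn Un Hs wt (comp_fcrit KD) (DU KD) aU z'U aK z'K az'
    (ex_intro2 _ _ u uK Hua) (ex_intro2 _ _ z zK Hz) sub bad2 (comp_bad KD) lt le.
  by rewrite -/(label K z') -/(short K) label_p short_p; lra.
have sub' e : w e != 0 -> e :&: K != set0 -> e \subset z' |: (a |: K).
  by rewrite setUCA; apply: sub.
have bad2' e : w e != 0 -> e :&: K != set0 -> #|e| = 3 -> ~~ matched H ((z' |: (a |: K)) :\: e).
  by rewrite setUCA; apply: bad2.
have z'a : z' != a by rewrite eq_sym.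
have := two_labels starn Un Hs wt (comp_fcrit KD) (DU KD) z'U aU z'K aK z'a
  (ex_intro2 _ _ z zK Hz) (ex_intro2 _ _ u uK Hua) sub' bad2' (comp_bad KD) lt le.
rewrite -/(label K a) -/(short K) short_p; move: cost_le; rewrite short_p; lra.
Qed.

Lemma point_faces z e : [set z] \in D -> w e != 0 -> z \in e -> e != p ->
  #|e| != 2%N -> #|e| = 3 /\ e \subset z |: A.
Proof.
move=> zD we ze eNp e2; have := face_in zD we eNp ze (set11 z); split=> //.
by have := w3 we; have := sz we; move: e2; case: #|e| => [|[|[|[|]]]].
Qed.

(** Apart from [p], the faces through [z] have size three with two points in [A]. If [A] has just
    two points, only [z |: A] is left to carry the weight that [p] misses at [z]. *)
Lemma point_apices z : [set z] \in D -> z \in p -> w p < 1 ->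
  (forall e, w e != 0 -> z \in e -> e != p -> #|e| != 2%N) ->
  (1 < #|A|)%N /\ (#|A| = 2 -> w (z |: A) = 1 - w p).
Proof.
move=> zD zp wp1 nopair; have zU : z \in U by apply: (subsetP (DU zD)); rewrite inE.
have zA : z \notin A by apply: (DA zD); rewrite inE.
have cz : #|z |: A| = #|A|.+1 by rewrite cardsU1 zA.
have ex := w1 zU; rewrite (bigD1 p) //= in ex.
split.
  have [/existsP[e /and3P[we ze eNp]]|/existsPn no] :=
    boolP [exists e : {set V}, [&& w e != 0, z \in e & e != p]].
    have [e3 se] := point_faces zD we ze eNp (nopair e we ze eNp).
    by have := subset_leq_card se; rewrite e3 cz.
  move: ex; rewrite big1 ?addr0 => [wp'|e /andP[ze eNp]]; first by rewrite wp' ltxx in wp1.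
  by apply/eqP/negPn/negP => we; have := no e; rewrite we ze eNp.
move=> A2; apply/eqP; rewrite eq_sym subr_eq -ex eq_sym addrC; apply/eqP; congr (_ + _).
rewrite (bigD1 (z |: A)) /=; last first.
  rewrite setU11 /=; apply/eqP => ez; have := cz; rewrite ez p2 A2; by [].
rewrite big1 ?addr0 // => e /andP[/andP[ze eNp] ne]; apply/eqP/negPn/negP => we.
have [e3 se] := point_faces zD we ze eNp (nopair e we ze eNp).
by case/negP: ne; rewrite eqEcard se cz A2 e3.
Qed.

(** The faces [x |: A] and [y |: A] take weight 2 - 2 w p at each point of [A]. Little remains for
    faces joining [A] to [K], so [K] must be met by much short weight besides [p]. *)
Lemma three_comps x y K a a' : x != y -> p = [set x; y] ->
  [set x] \in D -> [set y] \in D -> K \in D -> x \notin K -> y \notin K ->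
  a != a' -> A = [set a; a'] -> #|D| = 3 -> #|K| != 1%N -> w p < 1 ->
  (forall e, w e != 0 -> e != p -> #|e| = 2 -> x \notin e /\ y \notin e) ->
  3%:R / 2%:R <= small w.
Proof.
move=> xy ep xD yD KD xK yK aa' eA D3 K1 wp1 nopair.
have aA : a \in A by rewrite eA !inE eqxx.
have a'A : a' \in A by rewrite eA !inE eqxx orbT.
have aU := subsetP AU a aA; have a'U := subsetP AU a' a'A.
have aK : a \notin K by apply: contraL aA => /(DA KD).
have a'K : a' \notin K by apply: contraL a'A => /(DA KD).
have A2 : #|A| = 2 by rewrite eA cards2 aa'.
have xA : x \notin A by apply: (DA xD); rewrite inE.
have yA : y \notin A by apply: (DA yD); rewrite inE.
have pK t : t \in p -> t \in K -> False.
  by rewrite ep !inE => /orP[]/eqP->; [move: xK|move: yK] => /negP.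
have meet e : w e != 0 -> e :&: K != set0 -> e \subset K :|: A.
  move=> we /set0Pn[t /setIP[te tK]]; apply: (face_in KD we _ te tK).
  by apply/eqP => ee; apply: (pK t); rewrite // -ee.
have sub e : w e != 0 -> e :&: K != set0 -> e \subset a |: (a' |: K).
  by move=> we ne; rewrite setUA -eA setUC; apply: meet.
have eD : D = [set x] |: ([set y] |: [set K]).
  apply/esym/eqP; rewrite eqEcard D3; apply/andP; split.
    by apply/subsetP => X; rewrite !inE => /or3P[]/eqP->.
  rewrite !cardsU1 !inE cards1 negb_or.
  have -> : [set x] != [set y] by apply: contraNneq xy => /set1_inj->.
  have -> : [set x] != K by apply: contraNneq xK => <-; rewrite inE.
  by have -> : [set y] != K by apply: contraNneq yK => <-; rewrite inE.
have cov t : (t \in cover D) = [|| t == x, t == y | t \in K].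
  by rewrite eD /cover !bigcup_setU !big_set1 !inE.
have Hxy : H x y.
  by apply/shadowP; split=> //; exists p; rewrite ?inE // ep !inE !eqxx orbT.
have xU : x \in U by apply: (subsetP (DU xD)); rewrite inE.
have yU : y \in U by apply: (subsetP (DU yD)); rewrite inE.
have bad2 e : w e != 0 -> e :&: K != set0 -> #|e| = 3 ->
    ~~ matched H ((a |: (a' |: K)) :\: e).
  move=> we ne e3; apply: contra (bU we (eU we) e3) => m.
  have -> : U :\: e = ((a |: (a' |: K)) :\: e) :|: ([set x; y] :|: (U :\: A :\: cover D)).
    apply/setP => t; rewrite !in_setU !in_setD cov !in_set1.
    have [te|te] /= := boolP (t \in e).
      have := subsetP (meet e we ne) t te; rewrite inE => /orP[tK|tA].
        rewrite tK !orbT /= orbF; apply/esym/negbTE.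
        by rewrite negb_or; apply/andP; split; apply: contraTneq tK => ->.
      rewrite tA !andbF orbF; apply/esym/negbTE.
      by rewrite negb_or; apply/andP; split; apply: contraTneq tA => ->.
    rewrite eA !inE; have [->|ta] := eqVneq t a; first by rewrite aU.
    have [->|ta'] := eqVneq t a'; first by rewrite a'U.
    have [tK|tK] /= := boolP (t \in K); first by rewrite (subsetP (DU KD)).
    have [->|tx] /= := eqVneq t x; first by rewrite xU.
    by have [->|ty] /= := eqVneq t y; first by rewrite yU.
  apply: matchedU => //; last apply: matchedU => //.
  - rewrite -setI_eq0; apply/eqP/setP => t; rewrite [RHS]inE; apply/negP.
    rewrite setUA -eA => /setIP[/setDP[/setUP[tA|tK] _] /setUP[]].
    + by rewrite !inE => /orP[]/eqP et; [move: xA|move: yA]; rewrite -et tA.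
    + by rewrite !inE tA !andbF.
    + by rewrite !inE => /orP[]/eqP et; [move: xK|move: yK]; rewrite -et tK.
    + by rewrite inE cov tK !orbT.
  - rewrite -setI_eq0; apply/eqP/setP => t; rewrite [RHS]inE; apply/negP.
    case/setIP; rewrite !inE cov.
    by case/orP => ->; rewrite ?orbT.
  - by apply: matched_pair; rewrite // Hs.
  - exact: matched_subrel GH mR.
have lt : (#|K| + 2 < #|U|)%N.
  have : (#|x |: (y |: (a |: K))| <= #|U|)%N.
    apply: subset_leq_card; apply/subsetP => t; rewrite !inE.
    by case/or4P => [/eqP->|/eqP->|/eqP->|/(subsetP (DU KD))].
  rewrite !cardsU1 !inE (negPf xy) (negPf xK) (negPf yK) (negPf aK).
  have -> : (x == a) = false by apply: contraNF xA => /eqP->.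
  have -> : (y == a) = false by apply: contraNF yA => /eqP->.
  by rewrite /= !add1n addn2.
have exit b : b \in A -> b \in U -> b \notin K -> exists u c, [/\ u \in K, c \in A, c != b & H u c].
  by move=> bA bU' bK; apply: (comp_exit KD bU' bK) => t tp tK; case: (pK t).
have [u [c [uK cA ca' Huc]]] := exit a' a'A a'U a'K.
have ea : c = a by move: cA ca'; rewrite eA !inE => /orP[]/eqP-> //; rewrite eqxx.
have [u' [c' [u'K c'A ca Huc']]] := exit a aA aU aK.
have ea' : c' = a' by move: c'A ca; rewrite eA !inE => /orP[]/eqP-> //; rewrite eqxx.
rewrite ea in Huc; rewrite ea' in Huc'.
have A0 : A != set0 by apply/set0Pn; exists a.
have Kstar := comp_cost KD A0 K1.
have nx e : w e != 0 -> x \in e -> e != p -> #|e| != 2%N.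
  by move=> we xe eNp; apply/eqP => e2; have [/negP] := nopair e we eNp e2.
have ny e : w e != 0 -> y \in e -> e != p -> #|e| != 2%N.
  by move=> we ye eNp; apply/eqP => e2; have [_ /negP] := nopair e we eNp e2.
have xp : x \in p by rewrite ep !inE eqxx.
have yp : y \in p by rewrite ep !inE eqxx orbT.
have [_ /(_ A2) wx] := point_apices xD xp wp1 nx.
have [_ /(_ A2) wy] := point_apices yD yp wp1 ny.
have label_le b : b \in A -> b \in U -> label K b <= 2%:R * w p - 1.
  move=> bA bU'; have := w1 bU'.
  rewrite (bigD1 (x |: A)) /=; last by rewrite inE bA orbT.
  rewrite (bigD1 (y |: A)) /=; last first.
    rewrite inE bA orbT /=; apply: contraNneq xy => e.
    have : y \in x |: A by rewrite -e setU11.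
    by rewrite !inE (negPf yA) orbF eq_sym.
  have : label K b <= \sum_(e : {set V} | (b \in e) && (e != x |: A) && (e != y |: A)) w e.
    rewrite /label big_mkcond [leRHS]big_mkcond; apply: ler_sum => e _.
    case: ifP => [/andP[ne ->] /=|_]; last by case: ifP.
    have noK z : z \notin K -> e != z |: A.
      move=> zK; apply: contraTneq ne => ->; rewrite negbK; apply/eqP/setP => t.
      rewrite !inE; apply/negP => /andP[/orP[/eqP->|tA] tK]; first by rewrite tK in zK.
      by have := DA KD tK; rewrite tA.
    by rewrite !noK.
  by rewrite wx wy; lra.
have short_le : short K <= small w - w p.
  rewrite /small (bigD1 p) /=; last by rewrite p2.
  rewrite addrAC subrr add0r /short big_mkcond [leRHS]big_mkcond; apply: ler_sum => e _.
  case: ifP => [/andP[/set0Pn[t /setIP[te tK]] ->] /=|_]; last by case: ifP.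
  by have -> : e != p by apply/eqP => ee; apply: (pK t); rewrite // -ee.
have cost_le : cost w K <= short K + label K a + label K a'.
  rewrite /cost /short /label big_mkcond [X in _ <= X + _ + _]big_mkcond
    [X in _ <= _ + X + _]big_mkcond [X in _ <= _ + X]big_mkcond /= -!big_split /=.
  apply: ler_sum => e _; have we0 := w0 e.
  case: ifP => [/andP[gt0 lt3]|_]; last by rewrite !addr_ge0 //; case: ifP.
  have ne : e :&: K != set0 by rewrite -card_gt0.
  rewrite ne /=; have [->|we] := eqVneq (w e) 0; first by rewrite !if_same !addr0.
  case: (ltnP #|e| 3) => [_|ge3].
    by rewrite -addrA lerDl addr_ge0 //; case: ifP.
  have : (a \in e) || (a' \in e).
    apply: contraTT lt3; rewrite negb_or => /andP[ae a'e]; rewrite -leqNgt; apply: (leq_trans ge3).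
    apply: subset_leq_card; rewrite subsetI subxx.
    apply/subsetP => v ve; have := subsetP (meet e we ne) v ve.
    rewrite eA !inE => /or3P[//|/eqP va|/eqP va]; first by rewrite -va ve in ae.
    by rewrite -va ve in a'e.
  case: (a \in e) => /= [_|->]; last by rewrite !add0r.
  by rewrite add0r lerDl; case: ifP.
(* Adding [two_labels] to 3/2 <= cost w K gives 2 <= 2 short + l for the larger label l. As l <= 2 w
   p - 1, short is at least 3/2 - w p, and [p] is not counted in it. *)
have la := label_le a aA aU; have la' := label_le a' a'A a'U.
have [le|/ltW le] := lerP (label K a') (label K a).
  have := two_labels starn Un Hs wt (comp_fcrit KD) (DU KD) aU a'U aK a'K aa'
    (ex_intro2 _ _ u uK Huc) (ex_intro2 _ _ u' u'K Huc') sub bad2 (comp_bad KD) lt le.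
  by rewrite -/(label K a') -/(short K); lra.
have sub' e : w e != 0 -> e :&: K != set0 -> e \subset a' |: (a |: K).
  by rewrite setUCA; apply: sub.
have bad2' e : w e != 0 -> e :&: K != set0 -> #|e| = 3 -> ~~ matched H ((a' |: (a |: K)) :\: e).
  by rewrite setUCA; apply: bad2.
have a'a : a' != a by rewrite eq_sym.
have := two_labels starn Un Hs wt (comp_fcrit KD) (DU KD) a'U aU a'K aK a'a
  (ex_intro2 _ _ u' u'K Huc') (ex_intro2 _ _ u uK Huc) sub' bad2' (comp_bad KD) lt le.
by rewrite -/(label K a) -/(short K); lra.
Qed.

End Pair.
Let charge_at p K : R := if #|K| == 1%N then 2%:R - w p else 3%:R / 2%:R.

(** Spreading [p] raises [small] by [w p]. Only the members containing an end of [p] can have a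
    reduced charge; any other singleton is charged 2, which is 1/2 above the common 3/2, and [X]
    collects such singletons. *)
Lemma pair_config p : w p != 0 -> #|p| = 2 ->
  exists x y A D K1 K2,
    [/\ x != y, p = [set x; y],
        forall e, w e != 0 -> e != p -> {in e &, forall u v, u != v -> del H x y u v},
        [/\ config (del H x y) U A D, #|D| = #|A|.+1 /\ A != set0,
            matched (del H x y) (U :\: A :\: cover D)
          & {in D, forall K, matched (del H x y) (U :\: K)}]
      & [/\ K1 \in D, K2 \in D, K1 != K2, x \in K1 & y \in K2]] /\
    forall X, X \subset D :\ K1 :\ K2 -> {in X, forall K, #|K| = 1%N} ->
      charge_at p K1 + charge_at p K2 + 3%:R / 2%:R * (#|A|%:R - 1) + 1 / 2%:R * #|X|%:R
        <= #|A|%:R + small w + w p.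
Proof.
move=> wp p2; have /cards2P[x [y [xy ep]]] : #|p| == 2 by rewrite p2.
have xp : x \in p by rewrite ep !inE eqxx.
have yp : y \in p by rewrite ep !inE eqxx orbT.
have sub : subrel (del H x y) (shadow (supp w :\ p)).
  move=> u v /and3P[/shadowP[uv [e eS /andP[ue ve]]] n1 n2]; apply/shadowP; split=> //.
  exists e; rewrite ?ue ?ve // !inE in eS *; rewrite eS andbT; apply/eqP => ee.
  move: ue ve uv n1 n2; rewrite ee ep !inE !xpair_eqE.
  by case/orP => /eqP->; case/orP => /eqP->; rewrite ?eqxx.
have nf : ~~ fcrit (del H x y) U.
  by apply: contra (crit wp); apply: sub_fcrit => u v _ _; apply: sub.
have faceG e : w e != 0 -> e != p -> {in e &, forall u v, u != v -> del H x y u v}.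
  move=> we eNp u v ue ve uv.
  have Huv : shadow (supp w :\ p) u v.
    by apply/shadowP; split=> //; exists e; rewrite ?ue // !inE eNp.
  have [//|nG] := boolP (del H x y u v).
  (* If another face contained both ends of [p], removing [p] would leave the shadow unchanged,
     against [crit]. *)
  have xye : (x \in e) && (y \in e).
    have := delP (sub_shadow (subD1set (supp w) p) Huv) nG.
    by case=> -[<- <-]; rewrite ue ve.
  case/negP: (crit wp); apply: sub_fcrit fU => a b _ _ /shadowP[ab [f fS abf]].
  apply/shadowP; split=> //; have [fp|fp] := eqVneq f p; last by exists f; rewrite // in_setD1 fp.
  exists e; first by rewrite !inE eNp.
  move: abf xye; rewrite fp ep !inE => /andP[/orP[]/eqP-> /orP[]/eqP->] //;
    by case/andP => xe ye; rewrite ?xe ?ye.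
have [A [D [[cf cDA [K1 [K2 exK]] mR mD] le]]] :
    exists A D,
    [/\ config (del H x y) U A D, #|D| = #|A|.+1 /\ A != set0,
        exists K1 K2, [/\ K1 \in D, K2 \in D, K1 != K2, x \in K1 & y \in K2],
        matched (del H x y) (U :\: A :\: cover D)
      & {in D, forall K, matched (del H x y) (U :\: K)}] /\
    \sum_(K in D) charge (spread w p) K <= #|A|%:R + small (spread w p).
  apply: (spread_config wp Hs _ fU nf) => // u v /shadowP[uv [e /setD1P[eNp]]].
  by rewrite inE => we /andP[ue ve]; apply: (faceG e).
exists x, y, A, D, K1, K2; split; first by split.
move=> X sX X1; have [K1D K2D K12 xK1 yK2] := exK; have [cD _] := cDA.
have wd d : w [set d] = 0 by apply/eqP/negPn/negP => /sz; rewrite cards1.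
have ch K t : t \in p -> t \in K -> charge (spread w p) K = charge_at p K.
  move=> tp tK; rewrite /charge /charge_at; case: ifP => // /cards1P[d ed].
  by move: tK; rewrite ed => /set1P td; rewrite -td spread_set1 ?p2 // tp.
move: le; rewrite (big_setD1 K1) //= (big_setD1 K2) /=; last by rewrite !inE eq_sym K12.
rewrite (ch K1 x) // (ch K2 y) // small_spread p2 /=.
have cDD : #|D :\ K1 :\ K2| = #|A|.-1.
  have e1 : #|D| = #|D :\ K1|.+1 by rewrite (cardsD1 K1) K1D.
  have e2 : #|D :\ K1| = #|D :\ K1 :\ K2|.+1.
    by rewrite (cardsD1 K2) in_setD1 eq_sym K12 K2D.
  by move: e1; rewrite e2 cD => -[->].
have A1 : (0 < #|A|)%N by rewrite card_gt0; case: cDA.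
have cDR : #|D :\ K1 :\ K2|%:R = #|A|%:R - 1 :> R.
  by rewrite cDD -[in RHS](prednK A1) -addn1 natrD addrK.
have : \sum_(K in D :\ K1 :\ K2) (3%:R / 2%:R + (if K \in X then 1 / 2%:R else 0)) <=
    \sum_(K in D :\ K1 :\ K2) charge (spread w p) K.
  apply: ler_sum => K KDD; rewrite /charge.
  have := KDD; rewrite !inE => /and3P[KK2 KK1 KD].
  have noz t K' : t \in p -> t \in K' -> K' \in D -> K != K' -> t \notin K.
    move=> tp tK' K'D; apply: contraNN => tK; apply/eqP.
    exact: (config_unique cf KD K'D tK tK').
  have [/cards1P[d ed]|nK] := boolP (#|K| == 1%N).
    have dp : d \notin p.
      rewrite ep !inE negb_or; apply/andP; split; apply/eqP => dd.
        by have := noz x K1 xp xK1 K1D KK1; rewrite ed inE dd eqxx.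
      by have := noz y K2 yp yK2 K2D KK2; rewrite ed inE dd eqxx.
    by rewrite ed spread_set1 ?p2 // (negPf dp); case: ifP => _; lra.
  case: ifP => [/X1 K1'|_]; last by rewrite addr0.
  by rewrite K1' eqxx in nK.
rewrite big_split /= sumr_const -big_mkcondr /=.
rewrite (eq_bigl (fun K => K \in X)) => [|K]; last first.
  by apply: andb_idl; apply: (subsetP sX).
rewrite sumr_const -[(3%:R / 2%:R) *+ _]mulr_natr -[(1 / 2%:R) *+ _]mulr_natr cDR.
lra.
Qed.

(** If w p <= 1/2, all charges are at least 3/2, so 3/2 (|A| + 1) <= |A| + small w + w p < |A| + 2,
    impossible for nonempty [A]. *)
Lemma pair_gt_half p : w p != 0 -> #|p| = 2 -> 1 / 2%:R < w p.
Proof.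
move=> wp p2; have [x [y [A [D [K1 [K2 [[_ _ _ [_ [_ A0] _ _] _] le]]]]]]] := pair_config wp p2.
rewrite ltNge; apply/negP => half.
have X0 : {in set0, forall K : {set V}, #|K| = 1%N} by move=> K; rewrite inE.
have := le set0 (sub0set _) X0; rewrite cards0.
have A1 : 1 <= #|A|%:R :> R by rewrite ler1n card_gt0.
have c K : 3%:R / 2%:R <= charge_at p K by rewrite /charge_at; case: ifP => _; lra.
by have := c K1; have := c K2; move: half b_lt; lra.
Qed.

(** A pair of weight 1 would be the only face at its end [x], but factor-criticality gives [x] a
    neighbour other than [y]. *)
Lemma pair_lt1 p : w p != 0 -> #|p| = 2 -> w p < 1.
Proof.
move=> wp p2; have /cards2P[x [y [xy ep]]] : #|p| == 2 by rewrite p2.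
have pU := subsetP (eU wp).
have xU : x \in U by apply: pU; rewrite ep !inE eqxx.
have yU : y \in U by apply: pU; rewrite ep !inE eqxx orbT.
have [|v [vU vx vy /shadowP[_ [e eS /andP[xe ve]]]]] := fcrit_nbr fU xU yU _.
  by rewrite eq_sym.
have ep' : e != p by apply: contraTneq ve => ->; rewrite ep !inE negb_or vx vy.
rewrite inE in eS.
have xp : x \in p by rewrite ep !inE eqxx.
have := two_faces xU xe xp ep'.
have : 0 < w e by rewrite lt_def eS w0.
lra.
Qed.

Lemma pairs_disjoint p q v : w p != 0 -> #|p| = 2 -> w q != 0 -> #|q| = 2 -> p != q ->
  v \in p -> v \in q -> False.
Proof.
move=> wp p2 wq q2 pq vp vq; have vU := subsetP (eU wp) v vp.
have := two_faces vU vp vq pq; have := pair_gt_half wp p2; have := pair_gt_half wq q2.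
lra.
Qed.

Lemma pairs_le2 p q r : w p != 0 -> #|p| = 2 -> w q != 0 -> #|q| = 2 ->
  w r != 0 -> #|r| = 2 -> q != p -> r != p -> r = q.
Proof.
move=> wp p2 wq q2 wr r2 qp rp; apply/eqP/negPn/negP => rq.
have : w p + (w q + w r) <= small w.
  rewrite /small (bigD1 p) ?p2 //= (bigD1 q) ?q2 //= (bigD1 r) /=; last by rewrite r2 rp rq.
  by rewrite !lerD2l lerDl sumr_ge0.
have := pair_gt_half wp p2; have := pair_gt_half wq q2; have := pair_gt_half wr r2.
move: b_lt; lra.
Qed.

Lemma minimal_false : False.
Proof.
have [p0 wp0 p02] := pair_exists.
have P0 : (w p0 != 0) && (#|p0| == 2) by rewrite wp0 p02.
case: (@Order.TotalTheory.arg_minP _ _ _ p0 (fun e : {set V} => (w e != 0) && (#|e| == 2)) w P0).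
move=> p /andP[wp /eqP p2] pmin {p0 wp0 p02 P0}.
have half := pair_gt_half wp p2; have lt1 := pair_lt1 wp p2.
(* As [p] is the lightest pair, a second pair forces w p < 3/4; without one, small w = w p < 1. *)
have bcase : small w = w p \/ 2%:R * w p <= small w.
  have [/existsP[q /and3P[wq /eqP q2 qp]]|/existsPn no] :=
    boolP [exists q : {set V}, [&& w q != 0, #|q| == 2 & q != p]].
    right; rewrite /small (bigD1 p) ?p2 //= (bigD1 q) ?q2 //= addrA.
    have : w p <= w q by apply: pmin; rewrite wq q2.
    set r := \sum_(e | _) w e; have : 0 <= r by apply: sumr_ge0.
    lra.
  left; rewrite /small (bigD1 p) ?p2 //= big1 ?addr0 // => e /andP[lt3 eNp].
  apply/eqP/negPn/negP => we; have := no e; rewrite we eNp andbT.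
  by have := sz we; move: lt3; case: #|e| => [|[|[|]]].
have [x [y [A [D [K1 [K2 [[xy ep faceG [cf [cDA A0] mR mD] [K1D K2D K12 xK1 yK2]] le]]]]]]] :=
  pair_config wp p2.
set G := del H x y in faceG cf mR mD.
have Gs : symmetric G by apply: del_sym.
have GH : subrel G H by move=> u v /delW.
have HG u v : H u v -> ~~ G u v -> u \in p /\ v \in p.
  by move=> Huv nG; have := delP Huv nG; rewrite ep !inE; case=> -[-> ->]; rewrite !eqxx ?orbT.
have xp : x \in p by rewrite ep !inE eqxx.
have yp : y \in p by rewrite ep !inE eqxx orbT.
have np e v : w e != 0 -> #|e| = 2 -> e != p -> v \in p -> v \notin e.
  by move=> we e2 eNp vp; apply/negP; apply: (pairs_disjoint wp p2 we e2 _ vp); rewrite eq_sym.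
have A1 : (0 < #|A|)%N by rewrite card_gt0.
have nopair z e : z \in p -> w e != 0 -> z \in e -> e != p -> #|e| != 2%N.
  by move=> zp we ze eNp; apply/eqP => e2; have := np e z we e2 eNp zp; rewrite ze.
have X0 : {in set0, forall K : {set V}, #|K| = 1%N} by move=> K; rewrite inE.
have le0 := le set0 (sub0set _) X0; rewrite cards0 mulr0 addr0 in le0.
have single K z : K \in D -> z \in p -> z \in K -> #|K| = 1%N -> K = [set z] /\ (1 < #|A|)%N.
  move=> KD zp zK /eqP/cards1P[d ed]; have eK : K = [set z] by move: zK; rewrite ed => /set1P->.
  split=> //; rewrite eK in KD.
  have [] := point_apices p2 faceG cf KD zp lt1 (fun e we ze eNp => nopair z e zp we ze eNp).
  by [].
have ge2R : (1 < #|A|)%N -> 2%:R <= #|A|%:R :> R by move=> ?; rewrite ler_nat.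
(* With two, one or no singletons among [K1], [K2], the bound [le0] says that 5/2 + |A|/2 <= small w
   + 3 w p, 2 + |A|/2 <= small w + 2 w p, or 3/2 + |A|/2 <= small w + w p. By [bcase] the right
   sides are below 4, 3 and 9/4, and a singleton forces |A| >= 2. What survives is |A| = 2 with two
   singletons and |A| = 1 with none. *)
have [k1|k1] := eqVneq #|K1| 1%N; have [k2|k2] := eqVneq #|K2| 1%N.
- have [eK1 gt1] := single K1 x K1D xp xK1 k1; have [eK2 _] := single K2 y K2D yp yK2 k2.
  have [gt2|le2] := ltnP 2 #|A|.
    have : 3%:R <= #|A|%:R :> R by rewrite ler_nat.
    by move: le0; rewrite /charge_at k1 k2 /=; case: bcase b_lt => ?; lra.
  have A2 : #|A| = 2 by apply/eqP; rewrite eqn_leq le2 gt1.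
  have D3 : #|D| = 3 by rewrite cDA A2.
  have /card_gt0P[K KDD] : (0 < #|D :\ K1 :\ K2|)%N.
    have e1 : #|D| = #|D :\ K1|.+1 by rewrite (cardsD1 K1) K1D.
    have e2 : #|D :\ K1| = #|D :\ K1 :\ K2|.+1.
      by rewrite (cardsD1 K2) in_setD1 eq_sym K12 K2D.
    by move: e1; rewrite e2 D3 => -[<-].
  have := KDD; rewrite !inE => /and3P[KK2 KK1 KD].
  (* A third singleton adds 1/2, so the left side reaches 4 again; otherwise [three_comps]
     applies. *)
  have [k|k] := eqVneq #|K| 1%N.
    have := le [set K]; rewrite sub1set cards1 => /(_ KDD) leK.
    have {leK} := leK _; rewrite /charge_at k1 k2 A2 /= mulr1 => leK.
    have : {in [set K], forall K : {set V}, #|K| = 1%N} by move=> K' /set1P->.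
    by move/leK; case: bcase b_lt => ?; lra.
  have /cards2P[a [a' [aa' eA]]] : #|A| == 2 by rewrite A2.
  have b3 : 3%:R / 2%:R <= small w.
    apply: (three_comps wp p2 GH HG faceG cf mR mD xy ep _ _ KD _ _ aa' eA D3 k lt1).
    + by rewrite -eK1.
    + by rewrite -eK2.
    + by apply/negP => xK; case/eqP: KK1; apply: (config_unique cf KD K1D xK xK1).
    + by apply/negP => yK; case/eqP: KK2; apply: (config_unique cf KD K2D yK yK2).
    + by move=> e we eNp e2; split; apply: np.
  by move: b_lt b3; lra.
- have [_ gt1] := single K1 x K1D xp xK1 k1; have := ge2R gt1.
  by move: le0; rewrite /charge_at k1 (negPf k2) /=; case: bcase b_lt => ?; lra.
- have [_ gt1] := single K2 y K2D yp yK2 k2; have := ge2R gt1.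
  by move: le0; rewrite /charge_at k2 (negPf k1) /=; case: bcase b_lt => ?; lra.
have [gt1|le1] := ltnP 1 #|A|.
  have := ge2R gt1.
  by move: le0; rewrite /charge_at (negPf k1) (negPf k2) /=; case: bcase b_lt => ?; lra.
have /cards1P[a eA] : #|A| == 1%N by rewrite eqn_leq le1 A1.
have D2 : #|D| = 2 by rewrite cDA eA cards1.
have apex := one_apex wp p2 GH HG faceG cf mR mD.
(* At most one pair besides [p] exists. If it meets [K1], it lies in [K1 :|: A] and misses [K2], so
   the two members swap roles. *)
have [/existsP[q /and4P[wq /eqP q2 qp qK1]]|/existsPn no] :=
  boolP [exists q : {set V}, [&& w q != 0, #|q| == 2, q != p & q :&: K1 != set0]]; last first.
  apply: (apex K1 K2 x y a) => // e we e2 eNp; apply/eqP/negPn/negP => eK.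
  by have := no e; rewrite we e2 eNp eK.
apply: (apex K2 K1 y x a) => //; first by rewrite eq_sym.
- by rewrite ep setUC.
- move=> e we e2 eNp; have -> := pairs_le2 wp p2 wq q2 we e2 qp eNp.
  have /set0Pn[t /setIP[tq tK1]] := qK1.
  have sq := face_in faceG cf K1D wq qp tq tK1.
  apply/setP => u; rewrite !inE; apply/negP => /andP[uq uK2].
  have := subsetP sq u uq; rewrite inE => /orP[uK1|uA].
    by case/eqP: K12; apply: (config_unique cf K1D K2D uK1 uK2).
  have /configP[_ _ _ sD _] := cf.
  by have := subsetP (sD K2 K2D) u uK2; rewrite inE uA.
Qed.

End Minimal.

(** * Reduction to the minimal counterexample *)

Section StarTheorem.
Variables (R : realFieldType) (V : finType).
Implicit Types (g h : rel V) (U A B K e f : {set V}) (D X : {set {set V}}).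
Implicit Types (w : {set V} -> R).
Local Open Scope ring_scope.

Lemma shadow_weighting g w U : weighting g w U -> within w U ->
  weighting (shadow (supp w)) w U.
Proof.
move=> [w0 w3 w1 wg] wU; split=> // e we u v /setIP[ue _] /setIP[ve _] uv.
by apply/shadowP; split=> //; exists e; rewrite ?inE ?ue.
Qed.

(** With more than |U| faces, [reduce_support] shrinks the support. Otherwise [shadow_card] leaves
    exactly |U| faces and no singleton; without a face [f] there are too few of them, so deleting
    [f] destroys factor-criticality. *)
Lemma star_within n g w U : star_below R V n -> (#|U| <= n)%N -> symmetric g ->
  within w U -> weighting g w U -> fcrit g U -> bad g w U -> #|U| != 1%N ->
  3%:R / 2%:R <= small w.
Proof.
move=> starn Un gs; have [m] := ubnP #|supp w|; elim: m w => // m IH w ltm wU wt fU bU U1.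
have [w0 w3 w1 wg] := wt.
have [lt|ge] := ltnP #|U| #|supp w|.
  have [w' [w'0 /properP[/subsetP sw' [e0 e0S e0S']] w'1 le]] := reduce_support w0 wU lt.
  have sw e : w' e != 0 -> w e != 0 by move=> we; have := sw' e; rewrite !inE; apply.
  apply: le_trans le; apply: IH => //.
  - rewrite -ltnS; apply: leq_trans ltm; rewrite ltnS; apply: proper_card.
    by apply/properP; split; [apply/subsetP|exists e0].
  - by move=> e /sw/wU.
  - split=> // [e /sw/w3//|v vU|e /sw]; first by rewrite w'1 // w1.
    exact: wg.
  - by move=> e /sw; apply: bU.
have sg : {in U &, subrel (shadow (supp w)) g}.
  move=> u v uU vU /shadowP[uv [e + /andP[ue ve]]]; rewrite inE => we.
  by apply: (wg e we); rewrite ?inE ?ue ?ve.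
pose g' x y := [&& g x y, x \in U & y \in U].
have gs' : symmetric g' by move=> x y; rewrite /g' gs [(x \in U) && _]andbC.
have g'g : subrel g' g by move=> x y /andP[].
have sg' : subrel (shadow (supp w)) g'.
  move=> u v Huv; have /shadowP[_ [e + /andP[ue ve]]] := Huv; rewrite inE => we.
  have [/subsetP eU _] := wU e we; rewrite /g' (eU u ue) (eU v ve) !andbT.
  by apply: sg => //; apply: eU.
have fU' : fcrit g' U.
  by apply: sub_fcrit fU => u v uU vU; rewrite /g' uU vU => ->.
have bU' : bad g' w U.
  by move=> e we eU e3; apply: contra (bU e we eU e3); apply: matched_subrel.
have wtS := shadow_weighting wt wU.
have bS : bad (shadow (supp w)) w U.
  by move=> e we eU e3; apply: contra (bU' e we eU e3); apply: matched_subrel.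
rewrite leNgt; apply/negP => b_lt.
have fS : fcrit (shadow (supp w)) U.
  apply/negPn/negP => nf.
  have := nonfcrit_cost starn Un gs' fU' bU' sg' (subxx _) wtS wU nf.
  by rewrite leNgt b_lt.
have faces e : e \in supp w -> e \subset U /\ (#|e| <= 3)%N.
  by rewrite inE => we; split; [case: (wU e we)|apply: w3].
have tri : {in supp w, forall e, #|e| = 3 -> ~~ matched (shadow (supp w)) (U :\: e)}.
  by move=> e eS e3; have [eU _] := faces e eS; apply: bS => //; rewrite inE in eS.
have card2 := shadow_card R faces fS tri U1.
have sub2 : [set e in supp w | (1 < #|e|)%N] \subset supp w.
  by apply/subsetP => e /setIdP[].
have eq2 : [set e in supp w | (1 < #|e|)%N] = supp w.
  by apply/eqP; rewrite eqEcard sub2 (leq_trans ge card2).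
have cS : #|supp w| = #|U|.
  by apply/eqP; rewrite eqn_leq ge /= -eq2.
apply: (@minimal_false R V n w U starn Un wU wtS fS bS b_lt) => //.
  move=> e we; have : e \in supp w by rewrite inE.
  by rewrite -{1}eq2 => /setIdP[].
move=> f wf; apply/negP => ff; have fin : f \in supp w by rewrite inE.
have sD := subD1set (supp w) f.
have facesD e : e \in supp w :\ f -> e \subset U /\ (#|e| <= 3)%N.
  by move/(subsetP sD)/faces.
have triD : {in supp w :\ f, forall e, #|e| = 3 ->
    ~~ matched (shadow (supp w :\ f)) (U :\: e)}.
  move=> e /(subsetP sD) eS e3; apply: contra (tri e eS e3).
  by apply: matched_subrel; apply: sub_shadow.
have := shadow_card R facesD ff triD U1.
apply/negP; rewrite -ltnNge -cS (cardsD1 f (supp w)) fin ltnS.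
by apply: subset_leq_card; apply/subsetP => e /setIdP[].
Qed.

(** The push-forward of [w] under intersection with [U]; the empty trace is dropped to satisfy
    [within]. *)
Definition trace w U f : R :=
  if (f \subset U) && (f != set0) then \sum_(e : {set V} | e :&: U == f) w e else 0.

Lemma trace_supp w U f : trace w U f != 0 ->
  [/\ f \subset U, f != set0 & exists2 e, w e != 0 & e :&: U = f].
Proof.
rewrite /trace; case: ifP => [/andP[fU f0] tf|_]; last by rewrite eqxx.
split=> //; have [/existsP[e /andP[we /eqP ef]]|/existsPn no] :=
  boolP [exists e : {set V}, (w e != 0) && (e :&: U == f)]; first by exists e.
case/negP: tf; apply/eqP; apply: big1 => e ef; apply/eqP/negPn/negP => we.
by have := no e; rewrite we ef.
Qed.

Lemma trace_sum w U (P : pred {set V}) : P set0 = false ->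
  \sum_(f | P f) trace w U f = \sum_(e : {set V} | P (e :&: U)) w e.
Proof.
move=> P0; rewrite /trace -big_mkcondr /=.
rewrite [RHS](partition_big (fun e : {set V} => e :&: U)
  (fun f => P f && ((f \subset U) && (f != set0)))) /=; last first.
  move=> e Pe; rewrite Pe subsetIr /=; apply: contraTneq Pe => ->.
  by rewrite P0.
apply: eq_bigr => f /andP[Pf _]; apply: eq_bigl => e.
by apply/esym/andb_idl => /eqP->.
Qed.

Theorem star g w U : symmetric g -> weighting g w U -> fcrit g U -> bad g w U ->
  #|U| != 1%N -> 3%:R / 2%:R <= cost w U.
Proof.
suff starn n : star_below R V n by move=> *; apply: (starn #|U|.+1).
elim: n => [|n IH] g' w' U' gs wt fU bU U1 ltn //.
have [w0 w3 w1 wg] := wt.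
have tU : within (trace w' U') U' by move=> f /trace_supp[].
have -> : cost w' U' = small (trace w' U').
  rewrite -(cost_within tU) /cost trace_sum; last by rewrite set0I cards0.
  by apply: eq_bigl => e; rewrite -setIA setIid.
apply: (star_within IH ltn gs tU) => //.
- split.
  + by move=> f; rewrite /trace; case: ifP => // _; apply: sumr_ge0.
  + move=> f /trace_supp[_ _ [e /w3 le <-]].
    by apply: leq_trans le; apply: subset_leq_card; apply: subsetIl.
  + move=> v vU; rewrite trace_sum ?inE // -(w1 v vU).
    by apply: eq_bigl => e; rewrite inE vU andbT.
  + move=> f /trace_supp[fU' _ [e we <-]]; rewrite -setIA setIid; exact: wg.
- move=> f /trace_supp[fU' _ [e we ef]] _ f3.
  (* Faces have at most three points, so a trace of size three is the whole face and badness carries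
     over. *)
  suff ee : e = f by apply: bU; rewrite // -ee.
  apply/esym/eqP; rewrite eqEcard -{1}ef subsetIl f3; exact: w3.
Qed.

End StarTheorem.

(** * Covers *)

Section Covers.
Variables (V : finType) (E : {set {set V}}) (g : rel V).
Implicit Types (W A K e : {set V}) (D X F : {set {set V}}).
Hypothesis gs : symmetric g.
Hypothesis gE : forall x y, g x y -> exists2 e, e \in E & (x \in e) && (y \in e).

(** The count is doubled so that the bounds for disjoint pieces add up without rounding. *)
Definition half_cover W k := exists F, [/\ F \subset E, W \subset cover F & 2 * #|F| <= k].

Lemma half_coverU W1 W2 k1 k2 : half_cover W1 k1 -> half_cover W2 k2 ->
  half_cover (W1 :|: W2) (k1 + k2).
Proof.
move=> [F1 [s1 c1 l1]] [F2 [s2 c2 l2]]; exists (F1 :|: F2); split.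
- by rewrite subUset s1.
- by rewrite /cover bigcup_setU setUSS.
- by apply: leq_trans (leq_add l1 l2); rewrite -mulnDr leq_mul2l (leq_card_setU _ _).1.
Qed.

Lemma half_coverW W W' k k' : W' \subset W -> k <= k' -> half_cover W k -> half_cover W' k'.
Proof.
move=> sW lk [F [sF cF lF]]; exists F; split=> //.
  exact: subset_trans cF.
exact: leq_trans lk.
Qed.

Lemma half_cover1 e : e \in E -> half_cover e 2.
Proof.
move=> eE; exists [set e]; rewrite sub1set eE cards1 /cover big_set1; split=> //.
Qed.

Lemma half_cover_matched W : matched g W -> half_cover W #|W|.
Proof.
move: W; apply: matched_ind => [|x y W xy xW yW gxy _ IH].
  by exists set0; rewrite sub0set cards0 /cover big_set0.
have [e eE /andP[xe ye]] := gE gxy.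
have := half_coverU (half_cover1 eE) IH; apply: half_coverW.
  by rewrite setUA setSU // subUset !sub1set xe.
by rewrite !cardsU1 !inE negb_or xy xW yW.
Qed.

(** The failure of badness: one face spends a single edge on three points, which makes up for the
    odd size of [K]. *)
Definition splittable K := [exists e in E, (e \subset K) && (#|e| == 3) && matched g (K :\: e)].

Lemma half_cover_splittable K : splittable K -> half_cover K #|K|.
Proof.
case/exists_inP => e eE /andP[/andP[eK /eqP e3] m].
have := half_coverU (half_cover1 eE) (half_cover_matched m); apply: half_coverW.
  by apply/subsetP => t tK; rewrite !inE tK andbT orbN.
by rewrite cardsD (setIidPr eK) e3; have := subset_leq_card eK; rewrite e3; lia.
Qed.

Lemma half_cover_cover X : {in X, forall K, half_cover K #|K|} ->
  half_cover (cover X) (\sum_(K in X) #|K|).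
Proof.
have [n] := ubnP #|X|; elim: n X => // n IH X ltX hX.
have [->|[K KX]] := set_0Vmem X.
  by exists set0; rewrite sub0set cards0 /cover big_set0 sub0set.
rewrite (cover_setD1 KX) (big_setD1 K) //=; apply: half_coverU; first exact: hX.
apply: IH; first by move: ltX; rewrite (cardsD1 K X) KX.
by move=> K' /setD1P[_]; apply: hX.
Qed.

(** For a barrier of largest excess d, Hall's theorem assigns the members of [D] to neighbours in
    [A] or, when splittable, to d spare slots. Hall's condition can fail only for a family without
    splittable members, which is the second alternative; a splittable member sees all slots, and
    then maximality of d gives the condition. *)
Lemma half_cover_or_config : half_cover [set: V] #|V| \/
  exists A D, [/\ config g [set: V] A D, #|A| < #|D| & {in D, forall K, ~~ splittable K}].
Proof.
have cf0 : config g [set: V] set0 set0.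
  apply/configP; split; rewrite ?sub0set //; try by move=> K; rewrite inE.
  by apply/trivIsetP => K K'; rewrite inE.
pose P (q : {set V} * {set {set V}}) := config g [set: V] q.1 q.2.
have P0 : P (set0, set0) by [].
(* This measures |D| - |A| shifted by |V|, so that natural subtraction is not truncated. *)
case: (arg_maxnP (fun q : {set V} * {set {set V}} => #|q.2| + (#|V| - #|q.1|)) P0).
case=> A D PAD mx; have cf : config g [set: V] A D := PAD.
have max A' D' : config g [set: V] A' D' -> #|D'| + #|A| <= #|D| + #|A'|.
  move=> cf'; have le : #|D'| + (#|V| - #|A'|) <= #|D| + (#|V| - #|A|) := mx (A', D') cf'.
  by have := max_card A; have := max_card A'; move: le; clear; lia.
have leAD : #|A| <= #|D| by have := max _ _ cf0; rewrite !cards0 add0n addn0.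
have mR : matched g ([set: V] :\: A :\: cover D).
  have [//|[A' [D' [cf' lt']]]] := gallai_tutte ([set: V] :\: A :\: cover D) gs.
  have [cfc [cA cD]] := config_cat gs cf cf'.
  by have := max _ _ cfc; rewrite cA cD -addnA leq_add2l addnC leq_add2l leqNgt lt'.
have [dAC [dR eV]] := config_split cf.
have /configP[AU tD fD sD clD] := cf.
have [D0|[K0 K0D]] := set_0Vmem D.
  left; have A0 : A = set0 by apply/eqP; rewrite -cards_eq0 -leqn0; rewrite D0 cards0 in leAD.
  by move: mR; rewrite A0 D0 /cover big_set0 !setD0 => /half_cover_matched; rewrite cardsT.
have /andP[/set0Pn[v0 _] _] := fD K0 K0D.
have [/existsP[X /and3P[sX lt /forall_inP bX]]|/existsPn nex] :=
  boolP [exists X : {set {set V}}, [&& X \subset D, #|nbrs (adj g A) X| < #|X|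
    & [forall K in X, ~~ splittable K]]].
  by right; exists (nbrs (adj g A) X), X; split=> //; apply: config_nbrs cf sX.
left; set d := #|D| - #|A|.
pose r K (t : V + 'I_d) := match t with inl a => adj g A K a | inr _ => splittable K end.
have inl_inj : injective (@inl V 'I_d) by move=> ? ? [].
have inr_inj : injective (@inr V 'I_d) by move=> ? ? [].
have subN X : @inl V 'I_d @: nbrs (adj g A) X \subset nbrs r X.
  by apply/subsetP => _ /imsetP[a /nbrsP[K KX rKa] ->]; apply/nbrsP; exists K.
have [X sX|f [fr fi]] := hall (inl v0) (r := r) (X := D).
  have [bX|/forall_inPn[K KX]] := boolP [forall K in X, ~~ splittable K].
    apply: leq_trans (subset_leq_card (subN X)); rewrite (card_imset _ inl_inj) leqNgt.
    by have := nex X; rewrite sX bX andbT.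
  rewrite negbK => gK.
  have : @inl V 'I_d @: nbrs (adj g A) X :|: @inr V 'I_d @: [set: 'I_d] \subset nbrs r X.
    rewrite subUset subN; apply/subsetP => _ /imsetP[i _ ->].
    by apply/nbrsP; exists K.
  move/subset_leq_card; apply: leq_trans.
  rewrite cardsU (_ : _ :&: _ = set0) ?cards0 ?subn0; last first.
    apply/setP => t; rewrite !inE; apply/negP => /andP[/imsetP[a _ ->] /imsetP[]]; by [].
  rewrite (card_imset _ inl_inj) (card_imset _ inr_inj) cardsT card_ord /d.
  rewrite -(leq_add2r #|A|) -addnA subnK // [leqRHS]addnC.
  exact: max (config_nbrs cf sX).
pose isl K := if f K is inl _ then true else false.
pose D1 := [set K in D | isl K]; pose D2 := [set K in D | ~~ isl K].
pose fa K := if f K is inl a then a else v0.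
have faE K : K \in D1 -> f K = inl (fa K) /\ adj g A K (fa K).
  case/setIdP => KD; have := fr K KD; rewrite /isl /fa.
  by case: (f K) => // a.
have leD2 : #|D2| <= d.
  rewrite -[d]card_ord -(card_imset (mem 'I_d) inr_inj).
  have fi2 : {in D2 &, injective f}.
    by move=> K K' /setIdP[KD _] /setIdP[K'D _]; apply: fi.
  rewrite -(card_in_imset fi2); apply: subset_leq_card; apply/subsetP => _ /imsetP[K /setIdP[_ KD] ->].
  by move: KD; rewrite /isl; case: (f K) => // i _; apply/imsetP; exists i.
have eD : #|D1| + #|D2| = #|D|.
  rewrite -[RHS](cardID isl); congr (_ + _); by apply: eq_card => K; rewrite !inE // andbC.
have D1D K : K \in D1 -> K \in D by case/setIdP.
have fai : {in D1 &, injective fa}.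
  move=> K K' KD1 K'D1 e; apply: fi; [exact: D1D|exact: D1D|].
  by rewrite (faE K KD1).1 (faE K' K'D1).1 e.
(* At most d members occupy slots, so at least |A| are assigned to [A], and by injectivity they
   exhaust it. *)
have fAA : fa @: D1 = A.
  apply/eqP; rewrite eqEcard card_in_imset //; apply/andP; split.
    by apply/subsetP => _ /imsetP[K /faE[_ /andP[]] ? _ ->].
  by rewrite -(leq_add2r #|D2|) eD -(subnKC leAD) leq_add2l.
have m1 : matched g (A :|: cover D1).
  rewrite -{1}fAA; apply: matched_glue => //.
  - by apply: trivIsetS tD; apply/subsetP => K; apply: D1D.
  - by move=> K /D1D/fD.
  - move=> K /faE[_ /andP[faA _]]; apply/bigcupP => -[K' /D1D K'D faK'].
    by have := subsetP (sD K' K'D) _ faK'; rewrite inE faA.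
  - by move=> K /faE[_ /andP[_ /exists_inP[x ? ?]]]; exists x.
have c2 : half_cover (cover D2) (\sum_(K in D2) #|K|).
  apply: half_cover_cover => K /setIdP[KD nl]; apply: half_cover_splittable.
  by have := fr K KD; move: nl; rewrite /isl; case: (f K).
have := half_coverU (half_coverU (half_cover_matched m1) c2) (half_cover_matched mR).
apply: half_coverW.
  rewrite {1}eV setSU // -setUA setUS //; apply/subsetP => t /bigcupP[K KD tK].
  rewrite inE; have [lK|lK] := boolP (isl K); apply/orP; [left|right];
    by apply/bigcupP; exists K; rewrite // inE KD.
have cV : #|V| = #|A| + #|cover D| + #|[set: V] :\: A :\: cover D|.
  rewrite -cardsT [LHS](congr1 (fun W : {set V} => #|W|) eV).
  by rewrite cardsU (disjoint_setI0 dR) cards0 subn0 cardsU (disjoint_setI0 dAC) cards0 subn0.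
rewrite cV leq_add2r.
apply: leq_trans (leq_add (leq_card_setU _ _).1 (leqnn _)) _.
rewrite -addnA leq_add2l.
have -> : #|cover D1| = \sum_(K in D1) #|K|.
  by apply/esym/eqP; apply: trivIsetS tD; apply/subsetP => K; apply: D1D.
have <- : \sum_(K in D) #|K| = #|cover D| by apply/eqP.
rewrite [leqRHS](bigID isl) /=; apply: eq_leq; congr (_ + _); apply: eq_bigl => K; by rewrite inE.
Qed.

End Covers.

Theorem corollary1p3 (R : realType) (H : hypergraph) (n : nat)
    (H_uniform : uniform 3 H) (card_V : #|vertex H| = n)
    (H_exact : exists f : {set vertex H} -> R, exact_fractional_edge_cover f) :
  ((rho H)%:R <= n%:R / 2 :> R)%R.
Proof.
have [f [f0 f1]] := H_exact.
(* The values of [f] off the edges are arbitrary, so they are reset to zero. *)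
pose w e : R := if e \in edges H then f e else 0%R.
have wE e : w e != 0%R -> e \in edges H by rewrite /w; case: ifP => //; rewrite eqxx.
have w3 e : w e != 0%R -> #|e| = 3 by move/wE/H_uniform.
have w1 v : (\sum_(e : {set vertex H} | v \in e) w e = 1)%R.
  rewrite -(f1 v) /w -big_mkcondr; apply: eq_bigl => e; exact: andbC.
pose g := shadow (supp w).
have wt : weighting g w [set: vertex H].
  apply: (@shadow_weighting R _ (fun _ _ => true)).
    split=> // [e|e /w3->] //; first by rewrite /w; case: ifP => // /f0.
  by move=> e we; rewrite subsetT -card_gt0 w3.
have wU : within w [set: vertex H] by move=> e we; rewrite subsetT -card_gt0 w3.
have gs : symmetric g by apply: shadow_sym.
have gE x y : g x y -> exists2 e, e \in supp w & (x \in e) && (y \in e).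
  by case/shadowP => _ [e]; exists e.
have [[F [sF cF leF]]|[A [D [cf lt nsp]]]] := half_cover_or_config gs gE.
  have covF : edge_cover F.
    rewrite /edge_cover eqEsubset subsetT cF !andbT; apply/subsetP => e /(subsetP sF).
    by rewrite inE; apply: wE.
  rewrite ler_pdivlMr ?ltr0n // -natrM ler_nat -card_V mulnC.
  by apply: leq_trans leF; rewrite leq_mul2l rho_le.
have small0 : small w = 0%R.
  by apply: big1 => e lt3; apply/eqP/negPn/negP => /w3 e3; rewrite e3 in lt3.
have /configP[_ _ fD sD _] := cf.
have charge_le : (\sum_(K in D) charge w K <= #|A|%:R + small w)%R.
  apply: (config_charge wt wU cf) => K KD K1; apply: (star gs) => //.
  - by apply: (sub_weighting _ (subsetT K) wt).
  - exact: fD.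
  - move=> e we eK e3; apply: contra (nsp K KD) => m.
    by apply/exists_inP; exists e; rewrite ?inE // eK e3 eqxx.
(* No face is a singleton or short, so 3/2 |D| <= |A|, against |A| < |D|. *)
have : (\sum_(K in D) 3%:R / 2%:R <= \sum_(K in D) charge w K :> R)%R.
  apply: ler_sum => K KD; rewrite /charge; case: ifP => // /eqP K1.
  have -> : w K = 0%R by apply/eqP/negPn/negP => /w3; rewrite K1.
  lra.
rewrite sumr_const -[(_ *+ _)%R]mulr_natr; move: charge_le; rewrite small0.
have : (#|A|%:R + 1 <= #|D|%:R :> R)%R by rewrite natr1 ler_nat.
have : (0 <= #|A|%:R :> R)%R by rewrite ler0n.
lra.
Qed.
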